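(* Let $(X,T)$ be a Polish dynamical system. If $V\subseteq\mathcal{M}_T(X)$ is closed, then the set $G(V)=\{x\in X:V(x)=V\}$ is co-analytic (is $\boldsymbol{\Pi}^1_1$). If, in addition, $X$ is compact, then $G(V)$ is a $\boldsymbol{\Pi}^0_3$ set.
   Context: A Polish dynamical system $(X,T)$ is a Polish space $X$ with a continuous map $T\colon X\to X$. $\mathcal{M}(X)$ is the space of Borel probability measures on $X$ with the weak$^*$ topology (convergence of integrals of bounded continuous functions); $\mathcal{M}_T(X)$ is the subspace of $T$-invariant measures. For $x\in X$, $n\ge1$, $\mathcal{E}(x,n)=\frac1n\sum_{j=0}^{n-1}\delta_{T^j(x)}$, and $V(x)$ is the set of limit points (limits of convergent subsequences) in $\mathcal{M}(X)$ of $(\mathcal{E}(x,n))_n$. $\boldsymbol{\Pi}^0_3$ sets are the countable intersections of $F_\sigma$ sets. *)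

(* Defs.v *)
From HB Require Import structures.
From mathcomp Require Import all_boot all_order all_algebra.
From mathcomp Require Import all_classical all_reals all_analysis borel_hierarchy.

Set Implicit Arguments.
Unset Strict Implicit.
Unset Printing Implicit Defensive.

Import Order.TTheory GRing.Theory Num.Theory.
Import numFieldNormedType.Exports.

Local Open Scope classical_set_scope.
Local Open Scope ring_scope.

(** ** Polish spaces, co-analytic sets and the class Pi^0_3 *)

Definition is_metric (R : realType) (X : Type) (d : X -> X -> R) : Prop :=
  [/\ forall x y, 0 <= d x y,
      forall x y, d x y = 0 <-> x = y,
      forall x y, d x y = d y x &
      forall x y z, d x z <= d x y + d y z].

Definition metric_induces_topology (R : realType) (X : topologicalType)
    (d : X -> X -> R) : Prop :=
  forall (x : X) (A : set X),
    nbhs x A <-> exists2 e : R, 0 < e & [set y | d x y < e] `<=` A.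

Definition metric_complete (R : realType) (X : topologicalType)
    (d : X -> X -> R) : Prop :=
  forall u : nat -> X,
    (forall e : R, 0 < e -> exists N : nat, forall m n : nat,
       (N <= m)%N -> (N <= n)%N -> d (u m) (u n) < e) ->
    exists l : X, u @ \oo --> l.

Definition separable_space (X : topologicalType) : Prop :=
  exists2 D : set X, countable D & dense D.

Definition polish_space (R : realType) (X : topologicalType) : Prop :=
  separable_space X /\
  exists d : X -> X -> R,
    [/\ is_metric d, metric_induces_topology d & metric_complete d].

(* The Polish space [Y] is allowed to be empty, so that [set0] is analytic. *)
Definition analytic (R : realType) (X : topologicalType) (A : set X) : Prop :=
  exists (Y : topologicalType) (f : Y -> X),
    [/\ polish_space R Y, continuous f & range f = A].

Definition coanalytic (R : realType) (X : topologicalType) (A : set X) : Prop :=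
  analytic R (~` A).

Definition Pi03 (X : topologicalType) (A : set X) : Prop :=
  exists2 F : (set X)^nat, (forall n, Fsigma (F n)) & A = \bigcap_n F n.

(** ** Borel probability measures with the weak* topology *)

Definition borel (X : ptopologicalType) : measurableType (@open X).-sigma :=
  g_sigma_algebraType (@open X).

Record bounded_continuous (R : realType) (X : topologicalType) := BoundedContinuous {
  bc_fun :> X -> R ;
  bc_continuous : continuous bc_fun ;
  bc_bounded : bounded_fun bc_fun }.

Definition integrals (R : realType) (X : ptopologicalType)
    (mu : probability (borel X) R) :
    prod_topology (fun _ : bounded_continuous R X => R) :=
  fun f => \int[mu]_x f x.

(* A [probability] is a function on all subsets, constrained only on the
   measurable ones, so two of its inhabitants may represent the same Borel
   measure.  Such inhabitants have the same integrals, hence the same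
   neighbourhoods below: closed sets and sets of limits never separate them. *)
Definition prob_measures (R : realType) (X : ptopologicalType) : Type :=
  initial_topology (@integrals R X).

HB.instance Definition _ (R : realType) (X : ptopologicalType) :=
  Topological.copy (prob_measures R X) (initial_topology (@integrals R X)).

Lemma cvg_prob_measures (R : realType) (X : ptopologicalType)
    (mu_ : nat -> prob_measures R X) (mu : prob_measures R X) :
  mu_ @ \oo --> mu <->
  forall f : X -> R, continuous f -> bounded_fun f ->
    \int[mu_ n : probability (borel X) R]_x f x @[n --> \oo] -->
    \int[mu : probability (borel X) R]_x f x.
Proof.
pose BC := bounded_continuous R X.
split=> [cmu f cf bf U Uf|cmu U [_ [[B oB <-] Bmu BU]]].
  pose F : BC := BoundedContinuous cf bf.
  have cI : continuous (@integrals R X : prob_measures R X -> _).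
    exact: initial_continuous.
  have cF : continuous (fun g : {ptws BC -> R} => g F).
    exact: (@proj_continuous {classic BC} (fun=> R) F).
  exact: cmu (cI mu _ (cF (integrals mu) _ Uf)).
rewrite nbhs_filterE; apply: filterS BU _.
suff : integrals (mu_ n) @[n --> \oo] --> integrals mu.
  by apply; exact: open_nbhs_nbhs.
apply/(cvg_sup (fun i : BC => Topological.class
  (initial_topology (fun f : BC -> R => f i)))) => f W [_ [[C oC <-] Cf CW]].
rewrite nbhs_filterE; apply: filterS CW _.
apply: (cmu f (@bc_continuous _ _ f) (@bc_bounded _ _ f)).
exact: open_nbhs_nbhs.
Qed.

Definition invariant_measures (R : realType) (X : ptopologicalType)
    (T : X -> X) : set (prob_measures R X) :=
  [set mu : probability (borel X) R |
     forall A : set (borel X), measurable A -> mu (T @^-1` A) = mu A].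

(** ** Empirical measures and their limit points *)

Section empirical.
Context (R : realType) (X : ptopologicalType) (T : X -> X).

(* [empirical x n] is the average of the first [n.+1] Dirac masses. *)
Definition empirical (x : X) (n : nat) : set (borel X) -> \bar R :=
  mscale (n.+1%:R^-1)%:nng
    (msum (fun j => \d_(iter j T x : borel X)) n.+1).

HB.instance Definition _ (x : X) (n : nat) :=
  Measure.on (empirical x n).

Let empirical_setT (x : X) (n : nat) : empirical x n [set: borel X] = 1%E.
Proof.
rewrite /empirical /mscale /= /msum (eq_bigr (fun=> 1%E)) => [|i _].
  by rewrite sumEFin sumr_const card_ord -EFinM mulVf.
exact: diracT.
Qed.

HB.instance Definition _ (x : X) (n : nat) :=
  Measure_isProbability.Build _ _ _ (empirical x n) (empirical_setT x n).

Definition limit_measures (x : X) : set (prob_measures R X) :=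
  [set mu | exists2 phi : nat -> nat, increasing_seq phi &
     ((fun k => empirical x (phi k) : probability (borel X) R)
        : nat -> prob_measures R X) @ \oo --> mu].

Definition generic_points (V : set (prob_measures R X)) : set X :=
  [set x | limit_measures x = V].

End empirical.

(* Main.v *)
Require Import Defs.
From HB Require Import structures.
From mathcomp Require Import all_boot all_order all_algebra.
From mathcomp Require Import all_classical all_reals all_analysis.
From mathcomp Require Import measurable_realfun borel_hierarchy.
From mathcomp Require Import lra.

Set Implicit Arguments.
Unset Strict Implicit.
Unset Printing Implicit Defensive.

Import Order.TTheory GRing.Theory Num.Theory.
Import numFieldNormedType.Exports.

Local Open Scope classical_set_scope.
Local Open Scope ring_scope.

(** The weak* topology has a countable basis made of the sets [weak_open w] of
    measures giving finitely many "hat" functions (maxima of cones with rational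
    heights centred at a dense sequence) an integral above rational bounds,
    because every nonnegative bounded continuous function is a countable
    supremum of such functions.  Write [E(x,n)] for the empirical measures.

    [V] is not contained in [V(x)] iff some basic open set meeting [V] contains
    [E(x,n)] for only finitely many [n]: an F_sigma condition on [x].

    [V(x)] is not contained in [V] iff for some [w] whose closed version
    [weak_closed w] misses [V] there is a tight subsequence of [E(x,n)] in
    [weak_closed w]: convergent sequences are tight, and conversely a tight
    sequence has a cluster point (Prokhorov), which lies in [weak_closed w].
    Given the subsequence and moduli of tightness, this is a closed condition on
    [x], so the set of all such [x] is the projection of a closed subset of the
    product of [X] with a Baire space.  When [X] is compact every sequence is
    tight, and the inclusion of [V(x)] in [V] says that for each such [w]
    eventually [E(x,n)] is not in [weak_open w].

    The cluster point is obtained from an ultrafilter: the limits of integrals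
    form a positive functional, which tightness makes continuous along
    decreasing sequences, hence it is integration against a Borel measure. *)

(** * Bounded continuous functions *)

Section bcont.
Context (R : realType) (X : topologicalType).
Implicit Types f g : X -> R.

Definition bcont f := continuous f /\ exists M, forall x, `|f x| <= M.

Lemma bcont_bounded f : bcont f -> bounded_fun f.
Proof.
case=> _ [M fM]; exists M; split; first exact: num_real.
by move=> r Mr x _; exact: le_trans (fM x) (ltW Mr).
Qed.

Lemma bounded_bcont f : continuous f -> bounded_fun f -> bcont f.
Proof.
move=> cf [M [_ fM]]; split=> //; exists (M + 1) => x.
by apply: fM => //; rewrite ltrDl.
Qed.

Lemma bcont_cst (c : R) : bcont (fun=> c).
Proof. by split; [move=> x; exact: cvg_cst|exists `|c|]. Qed.

Lemma bcontD f g : bcont f -> bcont g -> bcont (fun x => f x + g x).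
Proof.
move=> [cf [M fM]] [cg [N gN]]; split.
  by move=> x; apply: cvgD; [exact: cf|exact: cg].
by exists (M + N) => x; rewrite (le_trans (ler_normD _ _))// lerD.
Qed.

Lemma bcontZ (c : R) f : bcont f -> bcont (fun x => c * f x).
Proof.
move=> [cf [M fM]]; split.
  by move=> x; apply: cvgM; [exact: cvg_cst|exact: cf].
by exists (`|c| * M) => x; rewrite normrM ler_wpM2l.
Qed.

Lemma bcontB f g : bcont f -> bcont g -> bcont (fun x => f x - g x).
Proof.
move=> bf bg; rewrite (_ : (fun x => _) = fun x => f x + (-1) * g x).
  exact: bcontD (bcontZ _ bg).
by apply/funext => x; rewrite mulN1r.
Qed.

Lemma bcont_max f g : bcont f -> bcont g -> bcont (fun x => Num.max (f x) (g x)).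
Proof.
move=> [cf [M fM]] [cg [N gN]]; split.
  by move=> x; apply: continuous_max; [exact: cf|exact: cg].
exists (M + N) => x; have M0 := le_trans (normr_ge0 _) (fM x).
have N0 := le_trans (normr_ge0 _) (gN x).
case: (leP (f x) (g x)) => _.
  by rewrite (le_trans (gN x))// lerDr.
by rewrite (le_trans (fM x))// lerDl.
Qed.

Lemma bcont_min f g : bcont f -> bcont g -> bcont (fun x => Num.min (f x) (g x)).
Proof.
move=> [cf [M fM]] [cg [N gN]]; split.
  by move=> x; apply: continuous_min; [exact: cf|exact: cg].
exists (M + N) => x; have M0 := le_trans (normr_ge0 _) (fM x).
have N0 := le_trans (normr_ge0 _) (gN x).
case: (leP (f x) (g x)) => _.
  by rewrite (le_trans (fM x))// lerDl.
by rewrite (le_trans (gN x))// lerDr.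
Qed.

Lemma bcont_sum (F : nat -> X -> R) n : (forall i, bcont (F i)) ->
  bcont (fun x => \sum_(i < n) F i x).
Proof.
move=> bF; elim: n => [|n ih].
  under eq_fun do rewrite big_ord0.
  exact: bcont_cst.
under eq_fun do rewrite big_ord_recr/=.
exact: bcontD.
Qed.

Lemma bcont_unit f : continuous f -> (forall x, 0 <= f x <= 1) -> bcont f.
Proof.
move=> cf f01; split=> //; exists 1 => x.
by have /andP[f0 f1] := f01 x; rewrite ger0_norm.
Qed.

Lemma bcont_open_gt f (c : R) : bcont f -> open [set x | c < f x].
Proof. by move=> [cf _]; move/continuousP: cf => /(_ _ (@open_gt R c)). Qed.

Lemma bcont_open_lt f (c : R) : bcont f -> open [set x | f x < c].
Proof. by move=> [cf _]; move/continuousP: cf => /(_ _ (@open_lt R c)). Qed.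

Lemma bcont_closed_ge f (c : R) : bcont f -> closed [set x | c <= f x].
Proof. by move=> [cf _]; apply: closed_comp (@closed_ge R c) => x _; exact: cf. Qed.

End bcont.

(** * Integration of bounded continuous functions *)

Section borel_integral.
Context (R : realType) (X : ptopologicalType).
Implicit Types (f g : X -> R) (mu : probability (borel X) R).

Lemma bcont_measurable f : bcont f -> measurable_fun [set: borel X] f.
Proof.
move=> bf; apply: (measurability _ (RGenOInfty.measurableE R)) => //.
move=> _ [_ [c ->] <-]; rewrite setTI; apply: sub_sigma_algebra.
rewrite (_ : _ @^-1` _ = [set x | c < f x]); first exact: bcont_open_gt.
by apply/seteqP; split => x /=; rewrite in_itv/= andbT.
Qed.

Lemma bcont_integrable mu f : bcont f -> mu.-integrable [set: borel X] (EFin \o f).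
Proof.
move=> bf; apply: measurable_bounded_integrable => //.
- by rewrite -ge0_fin_numE ?fin_num_measure.
- exact: bcont_measurable.
- exact: bcont_bounded.
Qed.

Lemma integral_bcontD mu f g : bcont f -> bcont g ->
  \int[mu]_x (f x + g x) = \int[mu]_x f x + \int[mu]_x g x.
Proof. by move=> bf bg; rewrite RintegralD//; exact: bcont_integrable. Qed.

Lemma integral_bcontB mu f g : bcont f -> bcont g ->
  \int[mu]_x (f x - g x) = \int[mu]_x f x - \int[mu]_x g x.
Proof. by move=> bf bg; rewrite RintegralB//; exact: bcont_integrable. Qed.

Lemma integral_bcontZ mu (c : R) f : bcont f ->
  \int[mu]_x (c * f x) = c * \int[mu]_x f x.
Proof. by move=> bf; rewrite RintegralZl//; exact: bcont_integrable. Qed.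

Lemma integral_prob_cst mu (c : R) : \int[mu]_x c = c.
Proof.
rewrite Rintegral_cst//; have /(congr1 fine)/= muT := probability_setT mu.
by rewrite -[RHS]mulr1 -muT.
Qed.

Lemma le_integral_bcont mu f g : bcont f -> bcont g ->
  (forall x, f x <= g x) -> \int[mu]_x f x <= \int[mu]_x g x.
Proof.
by move=> bf bg fg; apply: le_Rintegral => //; exact: bcont_integrable.
Qed.

Lemma integral_bcont_norm_le mu f (M : R) : bcont f ->
  (forall x, `|f x| <= M) -> `|\int[mu]_x f x| <= M.
Proof.
move=> bf fM; have fM' x : - M <= f x <= M by rewrite -ler_norml.
have h1 : \int[mu]_x (- M) <= \int[mu]_x f x.
  by apply: le_integral_bcont => // [|x]; [exact: bcont_cst|case/andP: (fM' x)].
have h2 : \int[mu]_x f x <= \int[mu]_x M.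
  by apply: le_integral_bcont => // [|x]; [exact: bcont_cst|case/andP: (fM' x)].
by move: h1 h2; rewrite !integral_prob_cst ler_norml => -> ->.
Qed.

Lemma integral_bcont_cvg mu (f_ : nat -> X -> R) f (M : R) :
  (forall n, bcont (f_ n)) -> bcont f -> (forall n x, `|f_ n x| <= M) ->
  (forall x, f_ ^~ x @ \oo --> f x) ->
  \int[mu]_x f_ n x @[n --> \oo] --> \int[mu]_x f x.
Proof.
move=> bf_ bf fM f_f.
have [|||||_ _ icvg] := @dominated_convergence _ (borel X) R mu setT measurableT
  (fun n => EFin \o f_ n) (EFin \o f) (EFin \o cst M).
- by move=> n; exact: (measurable_int mu (bcont_integrable mu (bf_ n))).
- exact: (measurable_int mu (bcont_integrable mu bf)).
- by apply: aeW => x _; apply: cvg_EFin (f_f x); exact: nearW.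
- exact: (bcont_integrable mu (bcont_cst X M)).
- by apply: aeW => x n _; rewrite /= lee_fin.
apply: fine_cvg; rewrite fineK//; apply: integrable_fin_num => //.
exact: bcont_integrable.
Qed.

End borel_integral.

(** * Riesz representation *)

Section riesz.
Context (R : realType) (X : ptopologicalType) (L : (X -> R) -> R).
Implicit Types (f g : X -> R) (G A : set X).

Hypothesis open_cozero : forall G, open G -> exists h : X -> R,
  [/\ continuous h, forall x, 0 <= h x <= 1 & forall x, G x <-> 0 < h x].
Hypothesis L_ge0 : forall f, bcont f -> (forall x, 0 <= f x) -> 0 <= L f.
Hypothesis LD : forall f g, bcont f -> bcont g ->
  L (fun x => f x + g x) = L f + L g.
Hypothesis LZ : forall (c : R) f, bcont f -> L (fun x => c * f x) = c * L f.
Hypothesis L1 : L (fun=> 1) = 1.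
(** Daniell's continuity condition. It stands in for compactness of the space and yields the
    countable subadditivity of [inner]. *)
Hypothesis L_smooth : forall f_ : nat -> X -> R, (forall n, bcont (f_ n)) ->
  (forall n x, 0 <= f_ n.+1 x <= f_ n x) -> (forall x, f_ ^~ x @ \oo --> (0 : R)) ->
  forall e, 0 < e -> exists n, L (f_ n) < e.

Let LB f g : bcont f -> bcont g -> L (fun x => f x - g x) = L f - L g.
Proof.
move=> bf bg; rewrite -mulN1r -LZ// -LD//; last exact: bcontZ.
by congr L; apply/funext => x; rewrite mulN1r.
Qed.

Let L_le f g : bcont f -> bcont g -> (forall x, f x <= g x) -> L f <= L g.
Proof.
move=> bf bg fg; rewrite -subr_ge0 -LB//; apply: L_ge0; first exact: bcontB.
by move=> x; rewrite subr_ge0.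
Qed.

Let L0 : L (fun=> 0) = 0.
Proof.
rewrite -[RHS](mul0r (L (fun=> 1))) -LZ; last exact: bcont_cst.
by congr L; apply/funext => x; rewrite mul0r.
Qed.

Let L_sum (F : nat -> X -> R) n : (forall i, bcont (F i)) ->
  L (fun x => \sum_(i < n) F i x) = \sum_(i < n) L (F i).
Proof.
move=> bF; elim: n => [|n ih].
  by rewrite big_ord0 -[RHS]L0; congr L; apply/funext => x; rewrite big_ord0.
rewrite big_ord_recr/= -ih -LD//; last exact: bcont_sum.
by congr L; apply/funext => x; rewrite big_ord_recr.
Qed.

Let below G := [set f : X -> R |
  [/\ continuous f, forall x, 0 <= f x <= 1 & forall x, ~ G x -> f x = 0]].

(** The value of the future measure on open sets, approximated from below by functions; [outer] then
    extends it to all sets by outer regularity. *)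
Let inner G : \bar R := ereal_sup [set (L f)%:E | f in below G].

Let outer A : \bar R :=
  ereal_inf [set inner G | G in [set G | open G /\ A `<=` G]].

Let below_bcont G f : below G f -> bcont f.
Proof. by case=> cf f01 _; exact: bcont_unit. Qed.

Let below0 G : below G (fun=> 0).
Proof. by split=> // [x|x]; [exact: cvg_cst|rewrite lexx ler01]. Qed.

Let inner_ge0 G : (0 <= inner G)%E.
Proof. by apply: ereal_sup_ubound; exists (fun=> 0); rewrite ?L0. Qed.

Let inner_le1 G : (inner G <= 1)%E.
Proof.
apply: ge_ereal_sup => _ [f Gf <-]; rewrite lee_fin -L1; apply: L_le.
- exact: below_bcont Gf.
- exact: bcont_cst.
- by case: Gf => _ f01 _ x; case/andP: (f01 x).
Qed.

Let inner_ub G f : below G f -> ((L f)%:E <= inner G)%E.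
Proof. by move=> Gf; apply: ereal_sup_ubound; exists f. Qed.

Let le_inner G H : G `<=` H -> (inner G <= inner H)%E.
Proof.
move=> GH; apply: ge_ereal_sup => _ [f [cf f01 f0] <-]; apply: inner_ub.
by split=> // x Hx; apply: f0 => /GH.
Qed.

Let inner0 : inner set0 = 0%E.
Proof.
apply/eqP; rewrite eq_le inner_ge0 andbT; apply: ge_ereal_sup => _ [f [_ _ f0] <-].
by rewrite lee_fin -[leRHS]L0 (_ : f = fun=> 0)//; apply/funext => x; exact: f0.
Qed.

(** Subtract from a function [f] below the union finitely many functions [k n i] below the [G_ i].
    The positive part [F n] of the remainder decreases pointwise to 0, so [L_smooth] makes its value
    under [L] smaller than [e]. *)
Let inner_subadditive (G_ : (set X)^nat) : (forall n, open (G_ n)) ->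
  (inner (\bigcup_n G_ n) <= \sum_(i <oo) inner (G_ i))%E.
Proof.
move=> oG; have [h hP] := choice (fun n => open_cozero (oG n)).
have ch n : continuous (h n) by case: (hP n).
have h01 n x : 0 <= h n x <= 1 by case: (hP n).
have hG n x : G_ n x <-> 0 < h n x by case: (hP n).
apply: ge_ereal_sup => _ [f Gf <-]; apply/lee_addgt0Pr => e e0.
(* As [n] grows these functions increase to the indicator function of [G_ i]. *)
pose k n i x := Num.min 1 (n%:R * h i x).
have bh i : bcont (h i) by exact: bcont_unit.
have bk n i : bcont (k n i) by apply: bcont_min; [exact: bcont_cst|exact: bcontZ].
have k0 n i x : 0 <= k n i x.
  by rewrite le_min ler01 mulr_ge0//; case/andP: (h01 i x).
have bf := below_bcont Gf.
pose F n x := Num.max 0 (f x - \sum_(i < n) k n i x).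
have bF n : bcont (F n).
  by apply: bcont_max; [exact: bcont_cst|apply: bcontB => //; exact: bcont_sum].
have kS n i x : k n i x <= k n.+1 i x.
  rewrite le_min !ge_min lexx/= ler_wpM2r ?orbT ?ler_nat//.
  by case/andP: (h01 i x).
have FS n x : 0 <= F n.+1 x <= F n x.
  rewrite le_max lexx/= ge_max !le_max lexx/=; apply/orP; right.
  rewrite lerD2l lerN2 big_ord_recr/=.
  apply: (@le_trans _ _ (\sum_(i < n) k n.+1 i x)); last by rewrite lerDl.
  by apply: ler_sum => i _; exact: kS.
have F0 x : F ^~ x @ \oo --> (0 : R).
  have [fx0|fx0] := eqVneq (f x) 0.
    rewrite (_ : F ^~ x = fun=> 0); first exact: cvg_cst.
    apply/funext => n; apply/max_idPl; rewrite fx0 sub0r oppr_le0.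
    exact: sumr_ge0.
  have [i _ Gi] : (\bigcup_n G_ n) x.
    by apply: contrapT; case: Gf => _ _ /[apply] /eqP; exact/negP.
  have hi0 : 0 < h i x by apply/hG.
  (* Once [n] is above [i] and at least [1 / h i x], the single term [k n i x] equals 1 and
     dominates [f x]. *)
  apply: cvg_near_cst; near=> n; apply/max_idPl; rewrite subr_le0.
  have lt_in : (i < n)%N by near: n; exact: nbhs_infty_gt.
  rewrite (bigD1 (Ordinal lt_in))//= (@le_trans _ _ (k n i x))//; last first.
    by rewrite lerDl sumr_ge0.
  rewrite le_min; apply/andP; split; first by case: Gf => _ /(_ x)/andP[].
  apply: (@le_trans _ _ 1); first by case: Gf => _ /(_ x)/andP[].
  rewrite -ler_pdivrMr// mul1r; near: n; exact: nbhs_infty_ger.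
have [n Fn] := L_smooth bF FS F0 e0.
apply: (@le_trans _ _ (\sum_(i < n) inner (G_ i) + e%:E)%E); last first.
  rewrite leeD2r// -(big_mkord xpredT (fun i => inner (G_ i))).
  exact: nneseries_lim_ge.
apply: (@le_trans _ _ ((\sum_(i < n) L (k n i))%:E + e%:E)%E); last first.
  rewrite leeD2r// -sumEFin; apply: lee_sum => i _; apply: inner_ub; split.
  - by case: (bk n i).
  - by move=> x; rewrite k0 ge_min lexx.
  - move=> x Gx; rewrite /k.
    suff -> : h i x = 0 by rewrite mulr0; apply/min_idPr; exact: ler01.
    apply/eqP; rewrite eq_le; case/andP: (h01 i x) => -> _; rewrite andbT leNgt.
    by apply/negP => /hG.
rewrite -EFinD lee_fin -L_sum//.
apply: (@le_trans _ _ (L (fun x => \sum_(i < n) k n i x + F n x))); last first.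
  by rewrite LD//; [rewrite lerD2l ltW|exact: bcont_sum].
apply: L_le => //; first by apply: bcontD => //; exact: bcont_sum.
by move=> x; rewrite -lerBlDl le_max lexx orbT.
Unshelve. all: by end_near. Qed.

Let outer_ge0 A : (0 <= outer A)%E.
Proof. by apply: le_ereal_inf_tmp => _ [G _ <-]. Qed.

Let outer_open G : open G -> outer G = inner G.
Proof.
move=> oG; apply/eqP; rewrite eq_le; apply/andP; split.
  by apply: ereal_inf_lbound; exists G => //; split.
by apply: le_ereal_inf_tmp => _ [H [_ GH] <-]; exact: le_inner.
Qed.

Let le_outer : {homo outer : A B / A `<=` B >-> (A <= B)%E}.
Proof.
move=> A B AB; apply: ereal_inf_le_tmp => _ [G [oG BG] <-].
by exists G => //; split => //; exact: subset_trans BG.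
Qed.

Let outer_fin A : outer A \is a fin_num.
Proof.
rewrite ge0_fin_numE//; apply: (@le_lt_trans _ _ 1%E); last exact: ltry.
apply: le_trans (inner_le1 setT); rewrite -outer_open; last exact: openT.
exact: le_outer.
Qed.

Let outer_adherent A e : 0 < e ->
  exists G, [/\ open G, A `<=` G & (inner G <= outer A + e%:E)%E].
Proof.
move=> e0; have [_ [G [oG AG] <-] Ge] := lb_ereal_inf_adherent e0 (outer_fin A).
by exists G; split=> //; exact: ltW.
Qed.

Let outer0 : outer set0 = 0%E.
Proof. by rewrite outer_open ?inner0//; exact: open0. Qed.

Let outer_subadditive : sigma_subadditive outer.
Proof.
move=> A; apply/lee_addgt0Pr => e e0.
apply: (le_trans _ (epsilon_trick xpredT (fun n => outer_ge0 (A n)) (ltW e0))).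
have en n : 0 < e / (2 ^ n.+1)%:R by rewrite divr_gt0// ltr0n expn_gt0.
have [G GP] := choice (fun n => outer_adherent (A n) (en n)).
apply: (@le_trans _ _ (inner (\bigcup_n G n))).
  rewrite -outer_open; last by apply: bigcup_open => n _; case: (GP n).
  by apply: le_outer; apply: subset_bigcup => n _; case: (GP n).
apply: le_trans (inner_subadditive _) _; first by move=> n; case: (GP n).
by apply: lee_nneseries => // n _; case: (GP n).
Qed.

Let outer_measure_of_L : {outer_measure set X -> \bar R} :=
  HB.pack outer
    (isOuterMeasure.Build R X outer outer0 outer_ge0 le_outer outer_subadditive).

(** Take an open [U] around [A] of nearly the same outer value, and [f] below [U] and [G] that
    nearly attains the inner value of their intersection. The part of [U] where [f] is small is open
    and contains [A] minus [G], and any [g] below it can be added to [f] with little overlap. The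
    error [e] is split into [e / 2] for [U], [e / 4] for [f] and [e / 4] for the overlap. *)
Let open_caratheodory G : open G -> outer_measure_of_L.-caratheodory G.
Proof.
move=> oG; apply: le_caratheodory_measurable => A /=.
apply/lee_addgt0Pr => e e0.
have e2 : 0 < e / 2 by rewrite divr_gt0.
have [U [oU AU Ue]] := outer_adherent A e2.
have e40 : 0 < e / 2 / 2 by rewrite divr_gt0.
apply: (@le_trans _ _ (inner U + (e / 2)%:E)%E); last first.
  by rewrite [e in leRHS]splitr EFinD addeA leeD2r.
have oUG : open (U `&` G) by exact: openI.
have inner_fin H : inner H \is a fin_num.
  by rewrite ge0_fin_numE// (le_lt_trans (inner_le1 H))// ltry.
have [_ [f fP <-] fe] := ub_ereal_sup_adherent e40 (inner_fin (U `&` G)).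
have bf := below_bcont fP.
apply: (@le_trans _ _ (inner (U `&` G) + inner (U `&` [set x | (f x < e / 2 / 2)%R]))%E).
  rewrite leeD//.
    by rewrite -outer_open//; apply: le_outer => x [/AU].
  rewrite -outer_open; last by apply: openI => //; exact: bcont_open_lt.
  apply: le_outer => x [/AU Ux Gx]; split=> //=.
  by case: fP => _ _ -> // -[].
apply: (@le_trans _ _ (((L f)%:E + (e / 2 / 2)%:E) +
  inner (U `&` [set x | (f x < e / 2 / 2)%R]))%E).
  by rewrite leeD2r// -leeBlDr// ltW.
have -> : ((e / 2)%:E = (e / 2 / 2)%:E + (e / 2 / 2)%:E)%E by rewrite -EFinD -splitr.
rewrite addeA (addeAC (L f)%:E) leeD2r//.
rewrite -leeBrDl//.
apply: ge_ereal_sup => _ [g gP <-]; rewrite leeBrDl// -EFinD.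
have bg := below_bcont gP.
have b0 : 0 < 1 + e / 2 / 2 by rewrite ltr_wpDl.
(* Where [f] is at least [e / 4] the function [g] vanishes, and elsewhere [f + g] is at most
   [1 + e / 4]; hence [w] has values in the unit interval. *)
pose w x := (1 + e / 2 / 2)^-1 * (f x + g x).
have wU : below U w.
  have bfg : bcont w by apply: bcontZ; exact: bcontD.
  case: fP gP => [cf f01 f0] [cg g01 g0]; split; first by case: bfg.
    move=> x; have /andP[fx0 fx1] := f01 x; have /andP[gx0 gx1] := g01 x.
    rewrite mulr_ge0 ?invr_ge0 ?addr_ge0//; last exact: ltW.
    rewrite ler_pdivrMl// mulr1.
    have [fe2|fe2] := ltP (f x) (e / 2 / 2).
      by rewrite addrC lerD// ltW.
    by rewrite g0 ?addr0 ?(le_trans fx1) ?lerDl 1?ltW//= => -[_]; rewrite ltNge fe2.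
  by move=> x Ux; rewrite /w f0 ?g0 ?addr0 ?mulr0// => -[].
have -> : L f + L g = L w + (e / 2 / 2) * L w.
  rewrite -LD// -{1}[L w]mul1r -mulrDl /w LZ; last exact: bcontD.
  by rewrite mulrA mulfV ?gt_eqF// mul1r.
rewrite EFinD leeD//; first exact: inner_ub.
rewrite lee_fin -[leRHS]mulr1 ler_wpM2l ?(ltW e40)// -lee_fin.
exact: le_trans (inner_ub wU) (inner_le1 _).
Qed.

Let borel_caratheodory (A : set (borel X)) :
  measurable A -> outer_measure_of_L.-caratheodory A.
Proof.
move: A; apply: smallest_sub; last by move=> G; exact: open_caratheodory.
split.
- exact: caratheodory_measurable_set0.
- by move=> A; rewrite setTD; exact: caratheodory_measurable_setC.
- by move=> F; exact: caratheodory_measurable_bigcup.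
Qed.

Let outer_sigma_additive : semi_sigma_additive (outer : set (borel X) -> \bar R).
Proof.
move=> F mF tF mUF.
apply: (@caratheodory_measure_sigma_additive R X outer_measure_of_L F) => //.
  by move=> i; exact: borel_caratheodory.
exact: borel_caratheodory.
Qed.

Let outer_setT : outer [set: borel X] = 1%E.
Proof.
rewrite outer_open; last exact: openT.
apply/eqP; rewrite eq_le inner_le1/= -[1%E in leLHS]/(1%:E) -L1.
apply: inner_ub; split.
- by move=> x; exact: cvg_cst.
- by move=> x; rewrite ler01 lexx.
- by move=> x [].
Qed.

Let outer_isMeasure := isMeasure.Build _ (borel X) R
  (outer : set (borel X) -> \bar R) outer0 outer_ge0 outer_sigma_additive.

Let outer_measure : {measure set (borel X) -> \bar R} :=
  HB.pack (outer : set (borel X) -> \bar R) outer_isMeasure.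

Let outer_probability : probability (borel X) R :=
  HB.pack (outer : set (borel X) -> \bar R) outer_isMeasure
    (Measure_isProbability.Build _ _ _ outer_measure outer_setT).

(** The slice of [t] between the levels [i * c] and [(i + 1) * c], for a layer-cake
    decomposition. *)
Let clip (c : R) i t := Num.min (Num.max 0 (t - i%:R * c)) c.

Let sum_clip c n t : 0 <= c -> 0 <= t ->
  \sum_(i < n) clip c i t = Num.min t (n%:R * c).
Proof.
move=> c0 t0; elim: n => [|n ih].
  by rewrite big_ord0 mul0r; apply/esym/min_idPr.
rewrite big_ord_recr/= ih /clip -natr1 mulrDl mul1r.
have : 0 <= n%:R * c by rewrite mulr_ge0.
move: (n%:R * c) => u u0; rewrite /Num.min /Num.max.
by repeat case: ifPn; rewrite -?leNgt; lra.
Qed.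

Let bcont_clip c i f : bcont f -> bcont (fun x => clip c i (f x)).
Proof.
move=> bf; apply: bcont_min; last exact: bcont_cst.
by apply: bcont_max; [exact: bcont_cst|apply: bcontB => //; exact: bcont_cst].
Qed.

(** Both sides are compared with [c] times the measure of [G], the set where [f] exceeds
    [(i + 1) * c]: the upper slice divided by [c] is below [G], and the lower slice equals [c] on
    all of [G]. *)
Let L_clipS c i f : 0 < c -> bcont f ->
  L (fun x => clip c i.+1 (f x)) <= \int[outer_probability]_x clip c i (f x).
Proof.
move=> c0 bf; pose G := [set x : borel X | i.+1%:R * c < f x].
have oG : open (G : set X) by exact: bcont_open_gt.
have mG : measurable G by exact: sub_sigma_algebra.
apply: (@le_trans _ _ (c * fine (outer_probability G))).
  rewrite -ler_pdivrMl// -LZ; last exact: bcont_clip.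
  rewrite -lee_fin fineK ?outer_fin//= outer_open//; apply: inner_ub.
  have bw : bcont (fun x => c^-1 * clip c i.+1 (f x)).
    by apply: bcontZ; exact: bcont_clip.
  split; first by case: bw.
    move=> x; rewrite ler_pdivrMl// mulr1; apply/andP; split; last first.
      by rewrite /clip ge_min lexx orbT.
    apply: mulr_ge0; first by rewrite invr_ge0 ltW.
    by rewrite /clip le_min le_max lexx/= ltW.
  move=> x /negP; rewrite -leNgt => fx; rewrite /clip.
  have /max_idPl -> : f x - i.+1%:R * c <= 0 by rewrite subr_le0.
  by have /min_idPl -> := ltW c0; rewrite mulr0.
have -> : c * fine (outer_probability G) = \int[outer_probability]_x (c * \1_G x).
  rewrite RintegralZl//; last exact: integrable_indic.
  by rewrite /Rintegral integral_indic// setIT.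
apply: le_Rintegral => //.
- rewrite (_ : EFin \o _ = fun x => (c%:E * (\1_G x)%:E)%E)//.
  by apply: integrableZl => //; exact: integrable_indic.
- by apply: bcont_integrable; exact: bcont_clip.
move=> x _; rewrite indicE; have [|_] := boolP (x \in G).
  rewrite inE => fx; rewrite mulr1 /clip le_min lexx andbT le_max.
  by apply/orP; right; move: fx; rewrite /G /mkset -natr1 mulrDl mul1r; lra.
by rewrite mulr0 /clip le_min le_max lexx/= ltW.
Qed.

(** Cut [f] into slices of height [c]. By [L_clipS] slice [i + 1] under [L] is at most slice [i]
    under the integral, so only the bottom slice is left over, and it costs at most [c], hence at
    most [e]. *)
Let L_le_integral f : continuous f -> (forall x, 0 <= f x <= 1) ->
  L f <= \int[outer_probability]_x f x.
Proof.
move=> cf f01; have bf := bcont_unit cf f01.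
apply/ler_addgt0Pr => e e0.
have [n ne] : exists n : nat, e^-1 <= n.+1%:R.
  by have [n _ /(_ n.+1 (leqnSn _))] := nbhs_infty_ger e^-1; exists n.
pose c : R := n.+1%:R^-1; have c0 : 0 < c by rewrite invr_gt0.
have ce : c <= e by rewrite -[e]invrK lef_pV2// ?posrE ?invr_gt0.
pose F (i : nat) x := clip c i (f x).
have bF i : bcont (F i) by exact: bcont_clip.
have fE : f = fun x => \sum_(i < n.+1) F i x.
  apply/funext => x; have /andP[fx0 fx1] := f01 x.
  rewrite sum_clip//; last exact: ltW.
  by rewrite mulfV//; apply/esym/min_idPl.
have int_sum m : \int[outer_probability]_x (\sum_(i < m) F i x) =
    \sum_(i < m) \int[outer_probability]_x F i x.
  elim: m => [|m ih].
    under eq_Rintegral do rewrite big_ord0.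
    by rewrite integral_prob_cst big_ord0.
  under eq_Rintegral do rewrite big_ord_recr/=.
  by rewrite integral_bcontD ?ih ?big_ord_recr//; exact: bcont_sum.
rewrite {1}fE L_sum// big_ord_recl/= addrC lerD//; last first.
  rewrite (le_trans _ ce)// -[leRHS]mulr1 -L1 -LZ; last exact: bcont_cst.
  apply: L_le => //; first exact: bcontZ (bcont_cst _ _).
  by move=> x; rewrite mulr1 /F /clip ge_min lexx orbT.
rewrite [in leRHS]fE int_sum big_ord_recr/= -[leLHS]addr0 lerD//.
  by apply: ler_sum => i _; exact: L_clipS.
apply: Rintegral_ge0 => x _; by rewrite /F /clip le_min le_max lexx/= ltW.
Qed.

(** For values in the unit interval, [L_le_integral] applied to [f] and to [1 - f] gives the two
    inequalities. A bounded function is rescaled affinely to this case. *)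
Theorem riesz_representation :
  exists mu : probability (borel X) R, forall f, bcont f -> \int[mu]_x f x = L f.
Proof.
exists outer_probability; set mu := outer_probability.
have eq01 f : continuous f -> (forall x, 0 <= f x <= 1) -> \int[mu]_x f x = L f.
  move=> cf f01; have bf := bcont_unit cf f01; have b1 := @bcont_cst R X 1.
  apply/eqP; rewrite eq_le L_le_integral// andbT.
  have : L (fun x => 1 - f x) <= \int[mu]_x (1 - f x).
    apply: L_le_integral; first by case: (bcontB b1 bf).
    by move=> x; have /andP[fx0 fx1] := f01 x; lra.
  by rewrite integral_bcontB// LB// integral_prob_cst L1; lra.
move=> f bf; have [_ [M0 fM0]] := bf.
pose M := `|M0| + 1; have M_gt0 : 0 < M by rewrite ltr_wpDl.
have fM x : - M <= f x <= M.
  rewrite -ler_norml (le_trans (fM0 x))// (le_trans (ler_norm _))//.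
  by rewrite lerDl.
have bM := @bcont_cst R X M.
pose h x := (2 * M)^-1 * (f x + M).
have bfM : bcont (fun x => f x + M) by exact: bcontD.
have : \int[mu]_x h x = L h.
  apply: eq01; first by case: (bcontZ (2 * M)^-1 bfM).
  move=> x; have /andP[fx1 fx2] := fM x; rewrite mulr_ge0 ?invr_ge0//=.
  - by rewrite ler_pdivrMl ?mulr_gt0// mulr1; lra.
  - by rewrite mulr_ge0// ltW.
  - by lra.
rewrite integral_bcontZ// LZ// => /(mulfI _); rewrite invr_eq0 mulf_neq0 ?gt_eqF//.
rewrite integral_bcontD// LD// integral_prob_cst.
have -> : L (fun=> M) = M.
  rewrite -[RHS]mulr1 -L1 -LZ; last exact: bcont_cst.
  by congr L; apply/funext => x; rewrite mulr1.
by move=> /(_ isT)/addIr.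
Qed.

End riesz.

(** * Prokhorov's theorem *)

(** The pigeonhole principle for ultrafilters; it will select one centre out of finitely many. *)
Lemma ultra_exists_bounded (U : set_system nat) (N : nat) (P : nat -> set nat) :
  UltraFilter U -> U [set n | exists2 i, (i < N)%N & P i n] ->
  exists2 i, (i < N)%N & U (P i).
Proof.
move=> UU; elim: N => [|N ih] UP; first by have /filter_ex[n [i]] := UP.
have [UPN|UPN] := in_ultra_setVsetC (P N) UU; first by exists N.
have [|i iN UPi] := ih; last by exists i => //; exact: ltnW.
apply: filterS (filterI UP UPN) => n [[i]]; rewrite ltnS leq_eqVlt.
by move=> /predU1P[->//|iN Pi] _; exists i.
Qed.

(** Compactness of the segment gives a cluster point, and an ultrafilter converges to each of its
    cluster points. *)
Lemma ultra_bounded_cvg (R : realType) (T : Type) (U : set_system T)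
    (u : T -> R) (M : R) :
  UltraFilter U -> (forall k, `|u k| <= M) -> cvg (u @ U).
Proof.
move=> UU uM; have M0 : - M <= M.
  have [k _] := filter_ex (@filterT _ U _).
  by have := le_trans (normr_ge0 _) (uM k); lra.
have := @segment_compact R (- M) M.
move=> /(_ (u @ U) _ _)[|p [_ pcl]].
  suff : U [set k | u k \in `[- M, M]] by [].
  apply: filterS (@filterT _ U _) => k _ /=.
  by have := uM k; rewrite in_itv/= ler_norml.
apply/cvg_ex; exists p => A /= pA.
have [//|UA] := in_ultra_setVsetC (u @^-1` A) UU.
have uA : (u @ U) (~` A) by [].
by have [q []] := pcl _ _ uA pA.
Qed.

Lemma natSinv_lt (R : realType) (r : R) : 0 < r ->
  \forall m \near \oo, m.+1%:R^-1 < r.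
Proof. by move=> r0; exact: (near_infty_natSinv_lt (PosNum r0)). Qed.

Section is_metric.
Context (R : realType) (X : Type) (d : X -> X -> R) (dm : is_metric d).

Lemma is_metric_ge0 x y : 0 <= d x y. Proof. by case: dm. Qed.
Lemma is_metric_xx x : d x x = 0.
Proof. by case: dm => _ d0 _ _; exact/d0. Qed.
Lemma is_metricC x y : d x y = d y x. Proof. by case: dm. Qed.
Lemma is_metric_triangle x y z : d x z <= d x y + d y z. Proof. by case: dm. Qed.

End is_metric.

Section metric.
Context (R : realType) (X : ptopologicalType) (d : X -> X -> R).
Hypothesis dm : is_metric d.
Hypothesis dtop : metric_induces_topology d.

Lemma metric_nbhs_ball x e : 0 < e -> nbhs x [set y | d x y < e].
Proof. by move=> e0; apply/dtop; exists e. Qed.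

Lemma continuous_metricP (f : X -> R) : continuous f <->
  forall x e, 0 < e -> exists2 r, 0 < r & forall y, d x y < r -> `|f x - f y| < e.
Proof.
split=> [cf x e e0|fP x].
  have /cvgrPdist_lt/(_ e e0)/dtop[r r0 rP] := cf x.
  by exists r => // y /rP.
apply/cvgrPdist_lt => e e0; have [r r0 rP] := fP x e e0.
by apply/dtop; exists r => // y /rP.
Qed.

Lemma lipschitz_continuous (f : X -> R) :
  (forall x y, f x <= d x y + f y) -> continuous f.
Proof.
move=> fL; apply/continuous_metricP => x e e0; exists e => // y xy.
rewrite ltr_norml; have := fL x y; have := fL y x; rewrite (is_metricC dm y x).
by lra.
Qed.

Lemma metric_open_cozero (G : set X) : open G -> exists h : X -> R,
  [/\ continuous h, forall x, 0 <= h x <= 1 & forall x, G x <-> 0 < h x].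
Proof.
(* The infimum of [S x] is the distance to the complement of [G] cut off at 1; the element 1 also
   keeps [S x] nonempty when [G] is the whole space. *)
move=> oG; pose S x : set R := [set 1] `|` [set d x y | y in ~` G].
have S0 x : S x !=set0 by exists 1; left.
have S_ge0 x : lbound (S x) 0.
  by move=> _ [->|[y _ <-]]; [exact: ler01|exact: (is_metric_ge0 dm)].
have Slb x : has_lbound (S x) by exists 0.
exists (fun x => inf (S x)); split.
- apply: lipschitz_continuous => x y; rewrite -lerBlDl.
  apply: lb_le_inf => // _ [->|[z Gz <-]].
    rewrite lerBlDl (le_trans (ge_inf (Slb x) (or_introl erefl)))//.
    by rewrite lerDr (is_metric_ge0 dm).
  rewrite lerBlDl; apply: le_trans (is_metric_triangle dm _ _ _).
  by apply: ge_inf => //; right; exists z.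
- move=> x; rewrite lb_le_inf//=.
  by apply: ge_inf => //; left.
- move=> x; split=> [Gx|]; last first.
    apply: contraPP => Gx; rewrite ltNge; apply/negP; rewrite negbK.
    by rewrite -(is_metric_xx dm x); apply: ge_inf => //; right; exists x.
  have /dtop[e e0 eG] : nbhs x G by exact: open_nbhs_nbhs.
  apply: (@lt_le_trans _ _ (Num.min 1 e)); first by rewrite lt_min ltr01 e0.
  apply: lb_le_inf => // _ [->|[y Gy <-]]; first by rewrite ge_min lexx.
  rewrite ge_min; apply/orP; right; rewrite leNgt; apply/negP => xy.
  exact/Gy/eG.
Qed.

(** * Cones and cover functions on a separable metric space *)

Context (a : nat -> X).
Hypothesis adense : forall x e, 0 < e -> exists i, d x (a i) < e.

(** The code [(i, m, q)] stands for the cone of height [q] over the ball of radius [1 / m] around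
    [a i], and for the constant [q] when [m] is 0. Codes form a countable type. *)
Definition hat (c : nat * nat * rat) x : R :=
  ratr c.2 * Num.max 0 (1 - c.1.2%:R * d x (a c.1.1)).

Definition hats (l : seq (nat * nat * rat)) x : R :=
  foldr (fun c r => Num.max (hat c x) r) 0 l.

(** A continuous substitute for the indicator function of the union of the balls of radius [1 / m]
    around the first [N] centres. *)
Definition cover_hat (m N : nat) : seq (nat * nat * rat) :=
  [seq (i, m, 1%Q) | i <- iota 0 N].

Lemma bcont_hat c : bcont (hat c).
Proof.
apply: bcontZ; apply: bcont_unit; last first.
  move=> x; rewrite le_max lexx/= ge_max ler01/= gerBl.
  by rewrite mulr_ge0// (is_metric_ge0 dm).
suff : continuous (fun x => d x (a c.1.1)).
  move=> cd x; apply: (@continuous_max R X (fun=> 0)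
    (fun x => 1 - c.1.2%:R * d x (a c.1.1))); first exact: cvg_cst.
  by apply: cvgB; [exact: cvg_cst|apply: cvgM; [exact: cvg_cst|exact: cd]].
by apply: lipschitz_continuous => x y; exact: (is_metric_triangle dm).
Qed.

Lemma bcont_hats l : bcont (hats l).
Proof.
elim: l => [|c l ih] /=; first exact: bcont_cst.
by apply: bcont_max => //; exact: bcont_hat.
Qed.

Lemma hats_ge0 l x : 0 <= hats l x.
Proof. by elim: l => [//|c l ih] /=; rewrite le_max ih orbT. Qed.

Lemma hats_leP l x (t : R) : 0 <= t ->
  hats l x <= t <-> forall c, c \in l -> hat c x <= t.
Proof.
move=> t0; elim: l => [|c l ih] /=; first by split.
rewrite ge_max; split=> [/andP[cx lx] c'|H].
  by rewrite inE => /predU1P[->//|]; exact: (proj1 ih lx).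
apply/andP; split; first by apply: H; rewrite mem_head.
by apply/ih => c' c'l; apply: H; rewrite inE c'l orbT.
Qed.

Lemma hat_le_hats l c x : c \in l -> hat c x <= hats l x.
Proof. by have /(hats_leP l x) := hats_ge0 l x; move=> [+ _]; exact. Qed.

Lemma cover_hat_le1 m N x : hats (cover_hat m N) x <= 1.
Proof.
apply/hats_leP => // _ /mapP[i _ ->]; rewrite /hat/= rmorph1 mul1r.
by rewrite ge_max ler01/= gerBl mulr_ge0// (is_metric_ge0 dm).
Qed.

Lemma cover_hat_le m N N' x : (N <= N')%N ->
  hats (cover_hat m N) x <= hats (cover_hat m N') x.
Proof.
move=> NN'; apply/hats_leP; first exact: hats_ge0.
move=> c /mapP[i iN ->]; apply: hat_le_hats; apply/mapP; exists i => //.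
by move: iN; rewrite !mem_iota !add0n/= => /leq_trans; exact.
Qed.

Lemma cover_hat_half m N x : 2^-1 < hats (cover_hat m N) x ->
  exists2 i, (i < N)%N & m%:R * d x (a i) < 2^-1.
Proof.
move=> H; apply: contrapT => Hno; move: H; apply/negP; rewrite -leNgt.
apply/hats_leP; first by lra.
move=> c /mapP[i]; rewrite mem_iota add0n /= => iN ->.
rewrite /hat/= rmorph1 mul1r ge_max; apply/andP; split; first by lra.
rewrite lerBlDl -lerBlDr leNgt; apply/negP => H; apply: Hno; exists i => //.
by lra.
Qed.

Lemma cover_hat_near m x (e : R) : 0 < e ->
  exists N0, forall N, (N0 <= N)%N -> 1 - e < hats (cover_hat m N) x.
Proof.
(* Dividing by [m.+1] keeps the radius meaningful when [m] is 0. *)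
move=> e0; have m0 : 0 < e / m.+1%:R by rewrite divr_gt0.
have [i xi] := adense x m0; exists i.+1 => N iN.
apply: (@lt_le_trans _ _ (hat (i, m, 1%Q) x)); last first.
  by apply: hat_le_hats; apply/mapP; exists i; rewrite // mem_iota add0n.
rewrite /hat/= rmorph1 mul1r lt_max; apply/orP; right.
rewrite ltrD2l ltrN2; apply: (@le_lt_trans _ _ (m.+1%:R * d x (a i))).
  by rewrite ler_wpM2r ?(is_metric_ge0 dm)// ler_nat.
by rewrite -ltr_pdivlMl// mulrC.
Qed.

Hypothesis dcomplete : metric_complete d.

(* A Dini-type bound: the cover functions with large index are all at least 1/2
   only on a totally bounded set, on which the decrease to 0 is uniform. *)
Lemma tight_dini (f_ : nat -> X -> R) (N : nat -> nat) (m0 : nat) (B e : R) :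
  (forall n, continuous (f_ n)) -> (forall n x, 0 <= f_ n.+1 x <= f_ n x) ->
  (forall x, f_ ^~ x @ \oo --> (0 : R)) -> (forall x, f_ 0%N x <= B) -> 0 < e ->
  exists n, forall x, f_ n x <=
    e + B * \sum_(i < n) (2 * (1 - hats (cover_hat (m0 + i) (N (m0 + i)%N)) x)).
Proof.
move=> cf fdec f0 fB e0; apply: contrapT => /forallNP H.
have {}H n : exists x, e + B * \sum_(i < n)
    (2 * (1 - hats (cover_hat (m0 + i) (N (m0 + i)%N)) x)) < f_ n x.
  by have /existsNP[x /negP] := H n; rewrite -ltNge; exists x.
have [x_ x_P] := choice H.
have fmono p n x : (p <= n)%N -> f_ n x <= f_ p x.
  elim: n => [|n ih]; first by rewrite leqn0 => /eqP ->.
  rewrite leq_eqVlt => /predU1P[->//|/ih]; apply: le_trans.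
  by case/andP: (fdec n x).
have B0 : 0 <= B.
  apply: le_trans (fB point); case/andP: (fdec 0%N point) => h1 h2.
  exact: le_trans h2.
pose t n i := 2 * (1 - hats (cover_hat (m0 + i) (N (m0 + i)%N)) (x_ n)).
have t0 n i : 0 <= t n i by rewrite mulr_ge0// subr_ge0 cover_hat_le1.
have fe n : e < f_ n (x_ n).
  apply: le_lt_trans (x_P n); rewrite lerDl mulr_ge0//.
  by apply: sumr_ge0 => i _; exact: t0.
(* Otherwise the summand of index [i] would be at least 1, and the lower bound [x_P] for
   [f_ n (x_ n)] would exceed [B]. *)
have half n i : (i < n)%N -> 2^-1 < hats (cover_hat (m0 + i) (N (m0 + i)%N)) (x_ n).
  move=> lt_in; rewrite ltNge; apply/negP => H1.
  have := lt_le_trans (x_P n) (le_trans (fmono _ _ (x_ n) (leq0n n)) (fB _)).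
  apply/negP; rewrite -leNgt -[leLHS]add0r lerD//; first exact: ltW.
  rewrite -[leLHS]mulr1 ler_wpM2l// (bigD1 (Ordinal lt_in))//=.
  rewrite -[leLHS]addr0 lerD//; first by lra.
  by apply: sumr_ge0 => j _; exact: t0.
(* Along a free ultrafilter the points [x_ n] stay, at each scale, close to one of the finitely many
   centres. The selected centres form a Cauchy sequence. *)
have [U [UU ooU]] := ultraFilterLemma (@eventually_filter).
have Ui m : exists i, U [set n | (m0 + m.+1)%:R * d (x_ n) (a i) < 2^-1].
  have [|i _ Ui] := @ultra_exists_bounded U (N (m0 + m.+1)%N)
      (fun i => [set n | (m0 + m.+1)%:R * d (x_ n) (a i) < 2^-1]) UU.
    apply: ooU; exists m.+2 => // n /= mn.
    exact/cover_hat_half/half.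
  by exists i.
have [i_ i_P] := choice Ui; pose y m := a (i_ m).
have Uy m : U [set n | d (x_ n) (y m) < m.+1%:R^-1].
  apply: (filterS _ (i_P m)) => n /= H1.
  rewrite -[ltRHS]mulr1 -ltr_pdivrMl ?invr_gt0// invrK.
  apply: le_lt_trans (lt_trans H1 _); last by lra.
  by rewrite ler_wpM2r ?(is_metric_ge0 dm)// ler_nat leq_addl.
have [l yl] : exists l : X, y @ \oo --> l.
  apply: dcomplete => r r0; have r2 : 0 < r / 2 by rewrite divr_gt0.
  have [M _ MP] := natSinv_lt r2; exists M => m n Mm Mn.
  have [k [km kn]] := filter_ex (filterI (Uy m) (Uy n)).
  apply: le_lt_trans (is_metric_triangle dm _ (x_ k) _) _; rewrite (is_metricC dm).
  rewrite [ltRHS]splitr ltrD//.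
    exact: lt_trans km (MP m Mm).
  exact: lt_trans kn (MP n Mn).
(* If [f_ p] were below [e] at [l], it would be so at some [x_ n] close to [l] with [n] at least
   [p], against [fe] and monotonicity. *)
have fl p : e <= f_ p l.
  rewrite leNgt; apply/negP => fpl.
  have /dtop[r r0 rP] : nbhs l [set z | f_ p z < e].
    apply: open_nbhs_nbhs; split=> //.
    by move/continuousP: (cf p) => /(_ _ (@open_lt R e)).
  have r2 : 0 < r / 2 by rewrite divr_gt0.
  have yr : \forall m \near \oo, d l (y m) < r / 2.
    exact: (yl _ (metric_nbhs_ball l r2)).
  have [m [ym mr]] := filter_ex (filterI yr (natSinv_lt r2)).
  have [n [nm pn]] := filter_ex (filterI (Uy m) (ooU _ (nbhs_infty_ge p))).
  have : f_ p (x_ n) < e.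
    apply: rP => /=; apply: le_lt_trans (is_metric_triangle dm _ (y m) _) _.
    rewrite (is_metricC dm (y m)) [ltRHS]splitr ltrD//.
    exact: lt_trans nm mr.
  by apply/negP; rewrite -leNgt ltW// (lt_le_trans (fe n))// fmono.
have /cvgrPdist_lt/(_ e e0)/filter_ex[p] := f0 l.
by rewrite sub0r normrN => /(le_lt_trans (ler_norm _)); rewrite ltNge fl.
Qed.

(** The tightness bounds pass to the limit functional [L], and since the errors [2^-m] are summable,
    [tight_dini] turns them into the smoothness required by [riesz_representation]. Convergence
    along a filter finer than [\oo] is enough to obtain a cluster point. *)
Lemma prokhorov (mu_ : nat -> probability (borel X) R) (N : nat -> nat) :
  (forall m k, 1 - (2 ^+ m)^-1 <= \int[mu_ k]_x hats (cover_hat m (N m)) x) ->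
  exists (U : set_system nat) (mu : probability (borel X) R),
    [/\ ProperFilter U, \oo `<=` U & forall f, bcont f ->
      \int[mu_ k]_x f x @[k --> U] --> \int[mu]_x f x].
Proof.
move=> tight; have [U [UU ooU]] := ultraFilterLemma (@eventually_filter).
pose I f k := \int[mu_ k]_x f x; pose L f := lim (I f @ U).
have Icvg f : bcont f -> I f @ U --> L f.
  move=> bf; have [_ [M fM]] := bf.
  apply: (@ultra_bounded_cvg R _ U _ M) => // k.
  exact: integral_bcont_norm_le.
have L_ge0 f : bcont f -> (forall x, 0 <= f x) -> 0 <= L f.
  move=> bf f0; apply: limr_ge; first exact: Icvg.
  by apply: nearW => k; exact: Rintegral_ge0.
have LD f g : bcont f -> bcont g -> L (fun x => f x + g x) = L f + L g.
  move=> bf bg; apply: cvg_lim => //.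
  rewrite (_ : I _ = I f \+ I g); first by apply: cvgD; exact: Icvg.
  by apply/funext => k; exact: integral_bcontD.
have LZ (c : R) f : bcont f -> L (fun x => c * f x) = c * L f.
  move=> bf; apply: cvg_lim => //.
  rewrite (_ : I _ = fun k => c * I f k); first by apply: cvgMr; exact: Icvg.
  by apply/funext => k; exact: integral_bcontZ.
have Lcst (c : R) : L (fun=> c) = c.
  apply: cvg_lim => //; rewrite (_ : I _ = fun=> c); first exact: cvg_cst.
  by apply/funext => k; exact: integral_prob_cst.
have LB f g : bcont f -> bcont g -> L (fun x => f x - g x) = L f - L g.
  move=> bf bg; apply: cvg_lim => //.
  rewrite (_ : I _ = I f \- I g); first by apply: cvgB; exact: Icvg.
  by apply/funext => k; exact: integral_bcontB.
have L_le f g : bcont f -> bcont g -> (forall x, f x <= g x) -> L f <= L g.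
  move=> bf bg fg; rewrite -subr_ge0 -LB//; apply: L_ge0; first exact: bcontB.
  by move=> x; rewrite subr_ge0.
have Ltight m : 1 - (2 ^+ m)^-1 <= L (hats (cover_hat m (N m))).
  apply: limr_ge; first exact/Icvg/bcont_hats.
  by apply: nearW => k; exact: tight.
suff [mu muP] : exists mu : probability (borel X) R,
    forall f, bcont f -> \int[mu]_x f x = L f.
  exists U, mu; split=> [||f bf]; [exact: ultra_proper|by []|].
  by rewrite muP//; exact: Icvg.
apply: riesz_representation => //; first exact: metric_open_cozero.
move=> f_ bf_ fdec f0 e e0; have [_ [B fB]] := bf_ 0%N.
have B0 : 0 <= B by apply: le_trans (fB point).
(* From level [m0] on, the deficits [2 * 2^-(m0 + i)] add up to at most [4 * 2^-m0], so their
   contribution stays below [e / 2]. *)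
have [m0 m0P] : exists m0 : nat, B * 4 * (2 ^+ m0)^-1 < e / 2.
  have : (fun m => B * 4 * (2 ^+ m)^-1) @ \oo --> B * 4 * 0.
    apply: cvgMr; rewrite (_ : (fun m => _) = fun m => 2^-1 ^+ m).
      by apply: cvg_expr; rewrite ger0_norm; lra.
    by apply/funext => m; rewrite exprVn.
  rewrite mulr0 => /cvgrPdist_lt/(_ (e / 2)).
  rewrite divr_gt0// => /(_ isT)/filter_ex[m] H; exists m; move: H.
  by rewrite sub0r normrN; exact: le_lt_trans (ler_norm _).
have e4 : 0 < e / 2 / 2 by rewrite !divr_gt0.
have [|n nP] := @tight_dini f_ N m0 B _ (fun n => (bf_ n).1) fdec f0 _ e4.
  by move=> x; exact: le_trans (ler_norm _) (fB x).
exists n; pose S i x := 2 * (1 - hats (cover_hat (m0 + i) (N (m0 + i)%N)) x).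
have bS i : bcont (S i).
  by apply: bcontZ; apply: bcontB; [exact: bcont_cst|exact: bcont_hats].
have LS k : L (fun x => \sum_(i < k) S i x) <= 4 * (2 ^+ m0)^-1 * (1 - (2 ^+ k)^-1).
  elim: k => [|k ih].
    rewrite expr0 invr1 subrr mulr0 (_ : (fun x => _) = fun=> 0) ?Lcst//.
    by apply/funext => x; rewrite big_ord0.
  rewrite (_ : (fun x => _) = fun x => \sum_(i < k) S i x + S k x); last first.
    by apply/funext => x; rewrite big_ord_recr.
  rewrite LD//; last exact: bcont_sum.
  have : L (S k) <= 2 * (2 ^+ (m0 + k))^-1.
    rewrite /S LZ; last by apply: bcontB; [exact: bcont_cst|exact: bcont_hats].
    rewrite ler_wpM2l// LB; [|exact: bcont_cst|exact: bcont_hats].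
    by rewrite Lcst lerBlDl -lerBlDr.
  rewrite exprD exprS !invfM.
  move: (2 ^+ m0)^-1 (2 ^+ k)^-1 ih => u v; lra.
apply: (@le_lt_trans _ _ (e / 2 / 2 + B * (4 * (2 ^+ m0)^-1))); last first.
  by move: m0P; rewrite -mulrA; move: (_ * (_ * _)) => u; lra.
apply: (@le_trans _ _ (e / 2 / 2 + B * L (fun x => \sum_(i < n) S i x))).
  have bs : bcont (fun x => \sum_(i < n) S i x) by exact: bcont_sum.
  have bc := bcont_cst X (e / 2 / 2); have bBs := bcontZ B bs.
  rewrite -(LZ B)// -[X in X + _]Lcst -LD//.
  by apply: L_le => //; exact: bcontD.
by rewrite lerD2l ler_wpM2l// (le_trans (LS n))// ler_piMr ?mulr_ge0 ?invr_ge0//.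
Qed.

End metric.

(** * A countable basis of the weak* topology *)

Lemma integral_continuous (R : realType) (X : ptopologicalType) (f : X -> R) :
  bcont f -> continuous (fun mu : prob_measures R X =>
    \int[mu : probability (borel X) R]_x f x).
Proof.
move=> bf; pose F := BoundedContinuous (proj1 bf) (bcont_bounded bf).
have cI : continuous (@integrals R X : prob_measures R X -> _).
  exact: initial_continuous.
have cF : continuous (fun g : {ptws bounded_continuous R X -> R} => g F).
  exact: (@proj_continuous {classic (bounded_continuous R X)} (fun=> R) F).
by move=> mu U Uf; exact: (cI mu _ (cF (integrals mu) _ Uf)).
Qed.

(** Convergence is tested for arbitrary filters because [weak_basis] applies it to a filter of sets
    of measures that does not come from a sequence. *)
Lemma cvg_filter_prob_measures (R : realType) (X : ptopologicalType)
    (F : set_system (prob_measures R X)) (mu : prob_measures R X) :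
  Filter F ->
  (forall f : X -> R, bcont f ->
    \int[nu : probability (borel X) R]_x f x @[nu --> F] -->
    \int[mu : probability (borel X) R]_x f x) ->
  F --> mu.
Proof.
move=> FF cF U [_ [[B oB <-] Bmu BU]].
rewrite nbhs_filterE; apply: filterS BU _.
suff : integrals nu @[nu --> F] --> integrals mu.
  by apply; exact: open_nbhs_nbhs.
apply/(cvg_sup (fun i : bounded_continuous R X => Topological.class
  (initial_topology (fun f : bounded_continuous R X -> R => f i))))
  => f W [_ [[C oC <-] Cf CW]].
rewrite nbhs_filterE; apply: filterS CW _.
apply: (cF f (bounded_bcont (@bc_continuous _ _ f) (@bc_bounded _ _ f))).
exact: open_nbhs_nbhs.
Qed.

Section weak_basis.
Context (R : realType) (X : ptopologicalType) (d : X -> X -> R).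
Hypothesis dm : is_metric d.
Hypothesis dtop : metric_induces_topology d.
Context (a : nat -> X).
Hypothesis adense : forall x e, 0 < e -> exists i, d x (a i) < e.

Local Notation hat := (hat d a).
Local Notation hats := (hats d a).

(** Choose a rational height slightly below [f x], a radius so small that [f] stays above this
    height on the cone, and a centre so close to [x] that the cone has lost little at [x]. *)
Lemma hat_approx (f : X -> R) x e : continuous f -> (forall y, 0 <= f y) ->
  0 < e -> exists c, (forall y, hat c y <= f y) /\ f x - e < hat c x.
Proof.
move=> cf f0 e0; have [fx|fx] := ltP (f x) e.
  exists (0%N, 0%N, 0%Q); rewrite /hat/= rmorph0; split; last by rewrite mul0r subr_lt0.
  by move=> y; rewrite mul0r.
have : f x - e / 2 < f x by rewrite gtrBl divr_gt0.
move=> /rat_in_itvoo[q]; rewrite in_itv/= => /andP[q1 q2].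
have q0 : 0 < ratr q :> R by move: q1; lra.
have fxq : 0 < f x - ratr q by rewrite subr_gt0.
have [r r0 rP] := proj1 (continuous_metricP dtop f) cf x _ fxq.
have r2 : 0 < r / 2 by rewrite divr_gt0.
have [m mr] := filter_ex (natSinv_lt r2).
pose M : R := m.+1%:R; have M0 : 0 < M by rewrite ltr0n.
(* The first bound keeps the support of the cone within [2 / M], hence within [r], of [x]; the
   second keeps the loss [ratr q * M * d x (a i)] below [e / 2]. *)
have eta0 : 0 < Num.min M^-1 (e / 2 / (ratr q * M)).
  have e2 : 0 < e / 2 by rewrite divr_gt0.
  by rewrite lt_min invr_gt0 M0 divr_gt0// mulr_gt0.
have [i] := adense x eta0; rewrite lt_min => /andP[xi1 xi2].
exists (i, m.+1, q); rewrite /hat/= -/M; split=> [y|].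
  have [ya|ya] := ltP 0 (1 - M * d y (a i)); last first.
    by rewrite mulr0.
  have : `|f x - f y| < f x - ratr q.
    apply: rP; apply: le_lt_trans (is_metric_triangle dm _ (a i) _) _.
    rewrite [ltRHS]splitr ltrD//; first exact: lt_trans mr.
    rewrite (is_metricC dm); apply: lt_trans mr; rewrite -[ltRHS]mulr1.
    by rewrite -ltr_pdivrMl ?invr_gt0// invrK -subr_gt0.
  rewrite ltr_norml => /andP[_ fy].
  apply: (@le_trans _ _ (ratr q)); last by move: fy; lra.
  rewrite -[leRHS]mulr1 ler_wpM2l//; first exact: ltW.
  by rewrite gerBl mulr_ge0 ?(ltW M0)// (is_metric_ge0 dm).
apply: (@lt_le_trans _ _ (ratr q * (1 - M * d x (a i)))); last first.
  by rewrite ler_wpM2l ?(ltW q0)// le_max lexx orbT.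
move: xi2; rewrite ltr_pdivlMr ?(mulr_gt0 q0 M0)//.
rewrite mulrC => xi2; rewrite mulrBr mulr1 mulrA; move: xi2.
by move: (_ * M * _) => u; lra.
Qed.

(** Enumerate the cones below [f]. The maxima of the first ones converge pointwise to [f] by
    [hat_approx], and bounded convergence applies. *)
Lemma hats_approx (mu : probability (borel X) R) (f : X -> R) e : bcont f ->
  (forall y, 0 <= f y) -> 0 < e -> exists l,
  (forall y, hats l y <= f y) /\ \int[mu]_x f x < \int[mu]_x hats l x + e.
Proof.
move=> bf f0 e0; have cf := proj1 bf.
pose good c := `[< forall y, hat c y <= f y >].
pose l n := [seq c <- pmap unpickle (iota 0 n) | good c].
have lf n y : hats (l n) y <= f y.
  by apply/hats_leP => // c; rewrite mem_filter => /andP[/asboolP].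
have lcvg y : hats (l n) y @[n --> \oo] --> f y.
  apply/cvgrPdist_lt => t t0; have [c [cf' cy]] := hat_approx y cf f0 t0.
  exists (pickle c).+1 => // n /= cn; rewrite ger0_norm ?subr_ge0//.
  apply: (@le_lt_trans _ _ (f y - hat c y)); last by move: cy; lra.
  rewrite lerD2l lerN2; apply: hat_le_hats.
  rewrite mem_filter; apply/andP; split; first exact/asboolP.
  rewrite mem_pmap; apply/mapP; exists (pickle c); last by rewrite pickleK.
  by rewrite mem_iota.
have [_ [M fM]] := bf.
have := @integral_bcont_cvg R X mu (fun n => hats (l n)) f M
  (fun n => bcont_hats dm dtop a (l n)) bf _ lcvg.
have lM n y : `|hats (l n) y| <= M.
  by rewrite ger0_norm ?hats_ge0// (le_trans (lf n y))// (le_trans (ler_norm _)).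
move=> /(_ lM).
move=> /cvgrPdist_lt/(_ e e0)/filter_ex[n] H; exists (l n); split=> //.
by move: (le_lt_trans (ler_norm _) H); lra.
Qed.

Definition weak_open (w : seq (seq (nat * nat * rat) * rat)) :
    set (prob_measures R X) :=
  [set mu : probability (borel X) R |
     forall c, c \in w -> ratr c.2 < \int[mu]_x hats c.1 x].

(** The non-strict version passes to limits of measures and, for empirical measures, is a closed
    condition on the point. *)
Definition weak_closed (w : seq (seq (nat * nat * rat) * rat)) :
    set (prob_measures R X) :=
  [set mu : probability (borel X) R |
     forall c, c \in w -> ratr c.2 <= \int[mu]_x hats c.1 x].

Lemma weak_open_closed w : weak_open w `<=` weak_closed w.
Proof. by move=> mu H c /H/ltW. Qed.

Lemma weak_open_cat w1 w2 : weak_open (w1 ++ w2) = weak_open w1 `&` weak_open w2.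
Proof.
apply/seteqP; split=> [mu H|mu [H1 H2] c].
  by split=> c cw; apply: H; rewrite mem_cat cw ?orbT.
by rewrite mem_cat => /orP[/H1|/H2].
Qed.

Lemma weak_closed_cat w1 w2 :
  weak_closed (w1 ++ w2) = weak_closed w1 `&` weak_closed w2.
Proof.
apply/seteqP; split=> [mu H|mu [H1 H2] c].
  by split=> c cw; apply: H; rewrite mem_cat cw ?orbT.
by rewrite mem_cat => /orP[/H1|/H2].
Qed.

Lemma open_weak_open w : open (weak_open w).
Proof.
elim: w => [|c w ih].
  by rewrite (_ : weak_open [::] = setT); [exact: openT|apply/seteqP; split].
rewrite -cat1s weak_open_cat; apply: openI => //.
rewrite (_ : weak_open _ = [set mu : prob_measures R X |
  ratr c.2 < \int[mu : probability (borel X) R]_x hats c.1 x]).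
  have /continuousP := integral_continuous (bcont_hats dm dtop a c.1).
  by move=> /(_ _ (@open_gt R (ratr c.2))).
apply/seteqP; split=> [mu|mu H c']; first by apply; rewrite mem_head.
by rewrite inE => /eqP ->.
Qed.

(** The sets [A] with the stated property form a filter, so it suffices that integrals of bounded
    continuous functions converge along it. *)
Lemma weak_basis (mu : prob_measures R X) (A : set (prob_measures R X)) :
  nbhs mu A -> exists w, weak_open w mu /\ weak_closed w `<=` A.
Proof.
move=> muA.
pose F : set_system (prob_measures R X) :=
  [set B | exists w, weak_open w mu /\ weak_closed w `<=` B].
have FF : Filter F.
  split.
  - by exists [::]; split.
  - move=> B C [w1 [w1mu w1B]] [w2 [w2mu w2C]]; exists (w1 ++ w2).
    rewrite weak_open_cat weak_closed_cat; split=> // nu [/w1B ? /w2C ?].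
    by split.
  - by move=> B C BC [w [wmu wB]]; exists w; split=> //; exact: subset_trans BC.
suff /(_ A muA) : F --> mu by [].
(* The lower bounds on [f] and on [- f] come from the approximations from below
   of [f + M] and [M - f]. *)
apply: cvg_filter_prob_measures => f bf; apply/cvgrPdist_lt => e e0.
pose P := (mu : probability (borel X) R).
have [cf [M fM]] := bf.
have fM' x : - M <= f x <= M by rewrite -ler_norml.
have bM := @bcont_cst R X M; have e2 : 0 < e / 2 by rewrite divr_gt0.
have bf1 := bcontD bf bM; have bf2 := bcontB bM bf.
have [|l1 [l1f l1e]] := @hats_approx P _ _ bf1 _ e2.
  by move=> y; have /andP[] := fM' y; lra.
have [|l2 [l2f l2e]] := @hats_approx P _ _ bf2 _ e2.
  by move=> y; have /andP[] := fM' y; lra.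
have rat_below (u : R) : exists q : rat, u - e / 2 < ratr q < u.
  have : u - e / 2 < u by rewrite gtrBl.
  by move=> /rat_in_itvoo[q]; rewrite in_itv/=; exists q.
have [q1 /andP[q1l q1u]] := rat_below (\int[P]_x hats l1 x).
have [q2 /andP[q2l q2u]] := rat_below (\int[P]_x hats l2 x).
exists [:: (l1, q1); (l2, q2)]; split.
  by move=> c; rewrite !inE => /orP[] /eqP ->.
move=> nu nuw /=.
have := nuw (l1, q1); rewrite mem_head => /(_ isT) /= n1.
have := nuw (l2, q2); rewrite !inE eqxx orbT => /(_ isT) /= n2.
have n1' := le_integral_bcont nu (bcont_hats dm dtop a l1) bf1 l1f.
have n2' := le_integral_bcont nu (bcont_hats dm dtop a l2) bf2 l2f.
move: l1e l2e n1' n2'.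
rewrite !integral_bcontB// !integral_bcontD// !integral_prob_cst.
by rewrite ltr_norml; move: q1l q2l n1 n2; lra.
Qed.

End weak_basis.

(** * Empirical measures *)

Lemma frequently_subseq (P : nat -> nat -> Prop) :
  (forall k N, exists2 n, (N <= n)%N & P k n) ->
  exists2 phi : nat -> nat, increasing_seq phi & forall k, P k (phi k).
Proof.
move=> H.
have {}H (kN : nat * nat) : exists n, (kN.2 <= n)%N /\ P kN.1 n.
  by have [n Nn Pn] := H kN.1 kN.2; exists n.
have [next nextP] := choice H.
pose phi := fix phi k := if k is k'.+1 then next (k, (phi k').+1) else next (0%N, 0%N).
exists phi; last first.
  case=> [|k]; first exact: (nextP (0%N, 0%N)).2.
  exact: (nextP (k.+1, (phi k).+1)).2.
by apply/increasing_seqP => k; exact: (nextP (k.+1, (phi k).+1)).1.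
Qed.

Lemma increasing_seq_ge (phi : nat -> nat) k : increasing_seq phi -> (k <= phi k)%N.
Proof.
move=> /increasing_seqP phiS; elim: k => // k ih.
by apply: leq_ltn_trans ih _; have := phiS k; rewrite ltEnat.
Qed.

Lemma iter_continuous (X : topologicalType) (T : X -> X) n :
  continuous T -> continuous (iter n T).
Proof.
move=> cT; elim: n => [|n ih] x /=; first exact: cvg_id.
exact: (continuous_comp (ih x) (cT _)).
Qed.

Section empirical.
Context (R : realType) (X : ptopologicalType) (T : X -> X).
Hypothesis cT : continuous T.

Local Notation E x n := (empirical R T x n : probability (borel X) R).

Lemma integral_empirical x n (f : X -> R) : bcont f -> (forall y, 0 <= f y) ->
  \int[E x n]_y f y = n.+1%:R^-1 * \sum_(j < n.+1) f (iter j T x).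
Proof.
move=> bf f0; rewrite /Rintegral.
have mf (mu : probability (borel X) R) := measurable_int mu (bcont_integrable mu bf).
rewrite ge0_integral_mscale//; last 2 first.
- exact: (mf (E x n)).
- by move=> y _; rewrite lee_fin.
rewrite ge0_integral_measure_sum//; last 2 first.
- by move=> y _; rewrite lee_fin.
- exact: (mf (E x n)).
rewrite (eq_bigr (fun j : 'I_n.+1 => (f (iter j T x))%:E)); last first.
  move=> j _; rewrite integral_dirac//; last exact: (mf (E x n)).
  by rewrite diracT mul1e.
by rewrite sumEFin.
Qed.

Lemma bcont_integral_empirical n (f : X -> R) : bcont f -> (forall y, 0 <= f y) ->
  bcont (fun x => \int[E x n]_y f y).
Proof.
move=> bf f0; under eq_fun do rewrite integral_empirical//.
apply: bcontZ; apply: (@bcont_sum R X (fun j x => f (iter j T x))) => j.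
case: bf => cf [M fM]; split; last by exists M.
move=> x; apply: (@continuous_comp _ _ _ (iter j T) f); last exact: cf.
exact: iter_continuous.
Qed.

Context (d : X -> X -> R).
Hypothesis dm : is_metric d.
Hypothesis dtop : metric_induces_topology d.
Context (a : nat -> X).
Hypothesis adense : forall x e, 0 < e -> exists i, d x (a i) < e.

Local Notation hats := (hats d a).
Local Notation weak_open := (weak_open d a).
Local Notation weak_closed := (weak_closed d a).

Lemma open_empirical_weak_open w n : open [set x | weak_open w (E x n)].
Proof.
elim: w => [|c w ih].
  by rewrite (_ : mkset _ = setT); [exact: openT|apply/seteqP; split].
rewrite (_ : mkset _ = [set x | ratr c.2 < \int[E x n]_y hats c.1 y] `&`
    [set x | weak_open w (E x n)]).
  apply: openI => //; apply: bcont_open_gt.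
  by apply: bcont_integral_empirical; [exact: bcont_hats|exact: hats_ge0].
apply/seteqP; split=> [x H|x [Hc Hw] c'].
  by split=> [|c' c'w]; apply: H; rewrite inE ?eqxx ?c'w ?orbT.
by rewrite inE => /predU1P[->//|]; exact: Hw.
Qed.

Lemma closed_empirical_weak_closed w n : closed [set x | weak_closed w (E x n)].
Proof.
elim: w => [|c w ih].
  by rewrite (_ : mkset _ = setT); [exact: closedT|apply/seteqP; split].
rewrite (_ : mkset _ = [set x | ratr c.2 <= \int[E x n]_y hats c.1 y] `&`
    [set x | weak_closed w (E x n)]).
  apply: closedI => //; apply: bcont_closed_ge.
  by apply: bcont_integral_empirical; [exact: bcont_hats|exact: hats_ge0].
apply/seteqP; split=> [x H|x [Hc Hw] c'].
  by split=> [|c' c'w]; apply: H; rewrite inE ?eqxx ?c'w ?orbT.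
by rewrite inE => /predU1P[->//|]; exact: Hw.
Qed.

Lemma limit_measures_frequently x (mu : prob_measures R X) w N :
  limit_measures T x mu -> weak_open w mu ->
  exists2 n, (N <= n)%N & weak_open w (E x n).
Proof.
move=> [phi phiI phicvg] wmu.
have : nbhs mu (weak_open w).
  by apply: open_nbhs_nbhs; split=> //; exact: open_weak_open.
move=> /phicvg wphi.
have {}wphi : \forall k \near \oo, weak_open w (E x (phi k)) by exact: wphi.
have [k [Nk kw]] := filter_ex (filterI (nbhs_infty_ge N) wphi).
exists (phi k) => //; apply: leq_trans Nk _; exact: increasing_seq_ge.
Qed.

(** A diagonal argument: [W k] joins those among the first [k] codes whose open sets contain [mu],
    and [phi k] is a time at which all these conditions hold in their closed form. *)
Lemma frequently_limit_measures x (mu : prob_measures R X) :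
  (forall w N, weak_open w mu -> exists2 n, (N <= n)%N & weak_closed w (E x n)) ->
  limit_measures T x mu.
Proof.
move=> H.
pose W k := flatten [seq w <- pmap unpickle (iota 0 k) | `[< weak_open w mu >]].
have Wmu k : weak_open (W k) mu.
  move=> c /flattenP[w]; rewrite mem_filter => /andP[/asboolP wmu _] cw.
  exact: wmu.
have [phi phiI phiW] := @frequently_subseq
  (fun k n => weak_closed (W k) (E x n)) (fun k N => H (W k) N (Wmu k)).
exists phi => // A /(weak_basis dm dtop adense)[w [wmu wA]].
exists (pickle w).+1 => // k /= wk; apply: wA => c cw; apply: phiW.
apply/flattenP; exists w => //; rewrite mem_filter; apply/andP; split.
  exact/asboolP.
rewrite mem_pmap; apply/mapP; exists (pickle w); last by rewrite pickleK.
by rewrite mem_iota.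
Qed.

(** By density the cover functions tend pointwise to 1 as [N] grows; bounded convergence gives the
    tightness of one measure. *)
Lemma integral_cover_hat (mu : probability (borel X) R) m e : 0 < e ->
  exists N0, forall N, (N0 <= N)%N -> 1 - e < \int[mu]_x hats (cover_hat m N) x.
Proof.
move=> e0; have : \int[mu]_x hats (cover_hat m n) x @[n --> \oo] --> \int[mu]_x (1 : R).
  apply: (@integral_bcont_cvg R X mu _ _ 1) => [n||n x|x].
  - exact: bcont_hats.
  - exact: bcont_cst.
  - by rewrite ger0_norm ?hats_ge0// cover_hat_le1.
  apply/cvgrPdist_lt => t t0; have [N0 N0P] := cover_hat_near dm adense m x t0.
  exists N0 => // N /= /N0P H.
  by rewrite ger0_norm ?subr_ge0 ?cover_hat_le1//; move: H; lra.
rewrite integral_prob_cst => /cvgrPdist_lt/(_ e e0)[N0 _ N0P].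
exists N0 => N /N0P /= /(le_lt_trans (ler_norm _)); lra.
Qed.

(** A bound for the limit measure serves all but finitely many terms, and the remaining ones are
    treated individually. *)
Lemma cvg_tight (mu_ : nat -> prob_measures R X) (mu : prob_measures R X) m e :
  0 < e -> mu_ @ \oo --> mu -> exists N, forall k,
  1 - e <= \int[mu_ k : probability (borel X) R]_x hats (cover_hat m N) x.
Proof.
move=> e0 mucvg.
have [N0 N0P] := integral_cover_hat (mu : probability (borel X) R) m e0.
have [k0 _ k0P] : \forall k \near \oo,
    1 - e < \int[mu_ k : probability (borel X) R]_x hats (cover_hat m N0) x.
  have /cvg_prob_measures/(_ _ (proj1 (bcont_hats dm dtop a (cover_hat m N0)))) := mucvg.
  move=> /(_ (bcont_bounded (bcont_hats dm dtop a _))) H.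
  by apply: (cvgr_gt _ H); exact: N0P.
have [Nk NkP] := choice (fun k =>
  integral_cover_hat (mu_ k : probability (borel X) R) m e0).
pose N := maxn N0 (\max_(k < k0) Nk k); exists N => k.
have [kk0|kk0] := ltnP k k0.
  apply/ltW/NkP; rewrite leq_max; apply/orP; right.
  exact: (leq_bigmax (Ordinal kk0)).
apply: le_trans (ltW (k0P _ kk0)) _.
apply: le_integral_bcont; [exact: bcont_hats|exact: bcont_hats|].
by move=> x; apply: cover_hat_le; exact: leq_maxl.
Qed.

(** An instance of Dini's theorem: the cover functions increase to 1, so a cluster point of
    counterexamples would contradict [cover_hat_near]. *)
Lemma compact_cover_hat m e : compact [set: X] -> 0 < e ->
  exists N, forall x, 1 - e <= hats (cover_hat m N) x.
Proof.
move=> cX e0; apply: contrapT => /forallNP H.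
have {}H n : exists x, hats (cover_hat m n) x < 1 - e.
  by have /existsNP[x /negP] := H n; rewrite -ltNge; exists x.
have [x_ x_P] := choice H.
have [|p [_ pcl]] := cX (x_ @ \oo) _; first exact: filterT.
have [N0 N0P] := cover_hat_near dm adense m p e0.
have pN : nbhs p [set x | 1 - e < hats (cover_hat m N0) x].
  apply: open_nbhs_nbhs; split; last exact: N0P.
  by apply: bcont_open_gt; exact: bcont_hats.
have xN : (x_ @ \oo) [set x | exists2 n, (N0 <= n)%N & x = x_ n].
  by exists N0 => // n /= N0n; exists n.
have [_ [[n N0n ->] /= H1]] := pcl _ _ xN pN.
have := lt_le_trans H1 (cover_hat_le d a m (x_ n) N0n).
by rewrite ltNge ltW.
Qed.

Hypothesis dcomplete : metric_complete d.

(** Here [N] is a modulus of tightness. Expressing it by integrals of continuous functions makes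
    every instance a closed condition on [x]. *)
Definition tight_at x (phi N : nat -> nat) := forall m k,
  1 - (2 ^+ m)^-1 <= \int[E x (phi k)]_y hats (cover_hat m (N m)) y.

(** The measure given by [prokhorov] is a limit along a filter finer than [\oo], so each of its
    basic neighbourhoods is visited at arbitrarily late times. *)
Lemma tight_limit_measure x (phi N : nat -> nat) w :
  increasing_seq phi -> tight_at x phi N ->
  (forall k, weak_closed w (E x (phi k))) ->
  exists2 mu, limit_measures T x mu & weak_closed w mu.
Proof.
move=> phiI tight wphi.
have [U [mu [PU ooU mucvg]]] := prokhorov dm dtop dcomplete tight.
exists mu; last first.
  move=> c cw; have bc := bcont_hats dm dtop a c.1.
  have H := mucvg _ bc.
  rewrite -(cvg_lim _ H)//; apply: limr_ge; first by apply/cvg_ex; eexists; exact: H.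
  by apply: nearW => k; exact: wphi.
apply: frequently_limit_measures => w' M w'mu.
have Uw : \forall k \near U, weak_open w' (E x (phi k)).
  elim: w' w'mu => [|c w' ih] w'mu; first by apply: nearW => k c.
  have H := mucvg _ (bcont_hats dm dtop a c.1).
  have Uc : \forall k \near U, ratr c.2 < \int[E x (phi k)]_y hats c.1 y.
    by apply: (cvgr_gt _ H); apply: w'mu; rewrite mem_head.
  have Uw' : \forall k \near U, weak_open w' (E x (phi k)).
    by apply: ih => c' c'w; apply: w'mu; rewrite inE c'w orbT.
  apply: filterS (filterI Uc Uw') => k [kc kw] c'.
  by rewrite inE => /predU1P[->//|]; exact: kw.
have [k [Mk kw]] := filter_ex (filterI (ooU _ (nbhs_infty_ge M)) Uw).
exists (phi k); last exact: weak_open_closed kw.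
by apply: leq_trans Mk _; exact: increasing_seq_ge.
Qed.

Context (V : set (prob_measures R X)).

Lemma not_sub_limit_measures x : ~ (V `<=` limit_measures T x) <->
  exists w N, weak_open w `&` V !=set0 /\
    forall n, (N <= n)%N -> ~ weak_open w (E x n).
Proof.
split=> [/existsNP[mu /not_implyP[Vmu xmu]]|[w [N [[mu [wmu Vmu]] wN]] H]].
  apply: contrapT => H; apply: xmu; apply: frequently_limit_measures.
  move=> w N wmu; apply: contrapT => H'; apply: H; exists w, N.
  split; first by exists mu.
  by move=> n Nn wn; apply: H'; exists n => //; exact: weak_open_closed wn.
have [n Nn wn] := limit_measures_frequently N (H _ Vmu) wmu.
exact: wN wn.
Qed.

Hypothesis clV : closed V.

Lemma limit_measures_separated x mu : limit_measures T x mu -> ~ V mu ->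
  exists2 w, weak_open w mu & weak_closed w `&` V = set0.
Proof.
move=> xmu Vmu; have : nbhs mu (~` V).
  by apply: open_nbhs_nbhs; split=> //; exact: closed_openC.
move=> /(weak_basis dm dtop adense)[w [wmu wV]]; exists w => //.
by apply/seteqP; split=> // nu [/wV].
Qed.

Lemma limit_measures_not_sub x : ~ (limit_measures T x `<=` V) <->
  exists w phi N, [/\ weak_closed w `&` V = set0, increasing_seq phi,
    tight_at x phi N & forall k, weak_closed w (E x (phi k))].
Proof.
split=> [/existsNP[mu /not_implyP[xmu Vmu]]|[w [phi [N [wV phiI tight wphi]]]] xV].
  have [w wmu wV] := limit_measures_separated xmu Vmu.
  have [phi phiI phicvg] := xmu.
  have : nbhs mu (weak_open w).
    by apply: open_nbhs_nbhs; split=> //; exact: open_weak_open.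
  move=> /phicvg[k0 _ k0P].
  have tN m : exists N, forall k, 1 - (2 ^+ m)^-1 <=
      \int[E x (phi k)]_y hats (cover_hat m N) y.
    by apply: cvg_tight phicvg; rewrite invr_gt0 exprn_gt0.
  have [N NP] := choice tN.
  (* Dropping the first [k0] terms turns an eventual property into one of every term. *)
  exists w, (fun k => phi (k0 + k)%N), N; split=> //.
  - by move=> i j; rewrite phiI leq_add2l.
  - by move=> k; apply: weak_open_closed; apply: k0P; exact: leq_addr.
have [mu xmu wmu] := tight_limit_measure phiI tight wphi.
by have : (weak_closed w `&` V) mu; [split=> //; exact: xV|rewrite wV].
Qed.

End empirical.

(** * Projections of closed sets *)

(** The proof [Dm] is a parameter of this alias of [Z] so that the topology of [D] can be inferred
    from the type. *)
Definition metric_type (R : realType) (Z : Type) (D : Z -> Z -> R)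
  (Dm : is_metric D) : Type := Z.

Section metric_type.
Context (R : realType) (Z : Type) (D : Z -> Z -> R) (Dm : is_metric D).

HB.instance Definition _ := gen_eqMixin (metric_type Dm).
HB.instance Definition _ := gen_choiceMixin (metric_type Dm).

Let metric_nbhs (p : metric_type Dm) : set_system (metric_type Dm) :=
  filter_from [set e : R | 0 < e] (fun e => [set q | D p q < e]).

HB.instance Definition _ := hasNbhs.Build (metric_type Dm) metric_nbhs.

Let metric_nbhs_filter (p : metric_type Dm) : ProperFilter (nbhs p).
Proof.
apply: filter_from_proper; last first.
  by move=> e e0; exists p; rewrite /= (is_metric_xx Dm).
apply: filter_from_filter; first by exists 1; exact: ltr01.
move=> e1 e2 /= e10 e20; exists (Num.min e1 e2).
  by rewrite /= lt_min e10 e20.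
by move=> q /=; rewrite lt_min => /andP[].
Qed.

Let metric_nbhs_singleton (p : metric_type Dm) (A : set (metric_type Dm)) :
  nbhs p A -> A p.
Proof. by move=> [e e0]; apply; rewrite /= (is_metric_xx Dm). Qed.

Let metric_nbhs_nbhs (p : metric_type Dm) (A : set (metric_type Dm)) :
  nbhs p A -> nbhs p (nbhs^~ A).
Proof.
move=> [e e0 eA]; exists e => // q /= pq; exists (e - D p q).
  by rewrite /= subr_gt0.
move=> r /= qr; apply: eA => /=; apply: le_lt_trans (is_metric_triangle Dm _ q _) _.
by rewrite -ltrBrDl.
Qed.

HB.instance Definition _ := Nbhs_isNbhsTopological.Build (metric_type Dm)
  metric_nbhs_filter metric_nbhs_singleton metric_nbhs_nbhs.

Lemma metric_type_topology :
  metric_induces_topology (D : metric_type Dm -> metric_type Dm -> R).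
Proof. by []. Qed.

End metric_type.

(** * The metric of the Baire space *)

Section baire_metric.
Context (R : realType) (K : Type).
Implicit Types z : nat -> K.

Definition agree n z z' := forall i, (i < n)%N -> z i = z' i.

Definition baire_dist z z' : R :=
  inf [set n.+1%:R^-1 | n in [set n | agree n z z']].

Let baire_set0 z z' :
  [set (n.+1%:R^-1 : R) | n in [set n | agree n z z']] !=set0.
Proof. by exists 1%:R^-1, 0%N. Qed.

Let baire_lb z z' :
  has_lbound [set (n.+1%:R^-1 : R) | n in [set n | agree n z z']].
Proof. by exists 0 => _ [n _ <-]; rewrite invr_ge0. Qed.

Lemma baire_dist_le n z z' : agree n z z' -> baire_dist z z' <= n.+1%:R^-1.
Proof. by move=> zz'; apply: ge_inf => //; exists n. Qed.

(** The strict bound forces an agreement longer than [n], hence the extra coordinate compared with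
    [baire_dist_le]. *)
Lemma baire_dist_lt n z z' : baire_dist z z' < n.+1%:R^-1 -> agree n.+1 z z'.
Proof.
move=> /(inf_lt (baire_set0 z z'))[_ [m mz <-]].
rewrite ltf_pV2 ?posrE ?ltr0n// ltr_nat ltnS => nm i ni.
by apply: mz; exact: leq_trans nm.
Qed.

Lemma baire_dist_metric : is_metric baire_dist.
Proof.
have d0 z z' : 0 <= baire_dist z z'.
  by apply: lb_le_inf => // _ [n _ <-]; rewrite invr_ge0.
split=> //.
- move=> z z'; split=> [zz'|->].
    by apply/funext => n; apply: (@baire_dist_lt n z z') => //; rewrite zz' invr_gt0.
  apply/eqP; rewrite eq_le d0 andbT; apply/ler_addgt0Pr => e e0; rewrite add0r.
  have [n ne] := filter_ex (natSinv_lt e0).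
  by apply: le_trans (ltW ne); exact: baire_dist_le.
- move=> z z'; congr inf; apply/seteqP.
  by split=> _ [n zn <-]; exists n => // i /zn.
- move=> x y z; rewrite -lerBlDr; apply: lb_le_inf => // _ [n xy <-].
  rewrite lerBlDr -lerBlDl; apply: lb_le_inf => // _ [m yz <-]; rewrite lerBlDl.
  have xz : agree (minn n m) x z.
    by move=> i; rewrite leq_min => /andP[ni mi]; rewrite xy// yz.
  apply: le_trans (baire_dist_le xz) _.
  have [nm|mn] := leqP n m; first by rewrite lerDl invr_ge0.
  by rewrite lerDr invr_ge0.
Qed.

End baire_metric.

(** * Closed subsets of the product with the Baire space are Polish *)

Section analytic_projection.
Context (R : realType) (X : ptopologicalType) (d : X -> X -> R).
Hypothesis dm : is_metric d.
Hypothesis dtop : metric_induces_topology d.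
Hypothesis dcomplete : metric_complete d.
Context (a : nat -> X).
Hypothesis adense : forall x e, 0 < e -> exists i, d x (a i) < e.
Context (K : countType) (P : nat -> X -> (nat -> K) -> Prop).
(** Closedness in the point, together with dependence on a bounded initial part of [z], makes each
    [P k] closed in the product. *)
Hypothesis closedP : forall k z, closed [set x | P k x z].
Hypothesis localP : forall k, exists n, forall z z' x,
  agree n z z' -> P k x z -> P k x z'.

Let Y := {p : X * (nat -> K) | forall k, P k p.1 p.2}.

Let D (p q : Y) : R :=
  d (sval p).1 (sval q).1 + baire_dist R (sval p).2 (sval q).2.

Let rm := @baire_dist_metric R K.

Let D_metric : is_metric D.
Proof.
split.
- by move=> p q; rewrite addr_ge0 ?(is_metric_ge0 dm) ?(is_metric_ge0 rm).
- move=> p q; split=> [|->]; last first.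
    by rewrite /D (is_metric_xx dm) (is_metric_xx rm) addr0.
  move/eqP; rewrite paddr_eq0 ?(is_metric_ge0 dm) ?(is_metric_ge0 rm)//.
  case: dm rm => _ dE _ _ [_ rE _ _].
  case: p q => [[x z] zP] [[x' z'] zP'] /= /andP[/eqP/dE xx' /eqP/rE zz'].
  by apply: eq_exist; rewrite xx' zz'.
- by move=> p q; rewrite /D (is_metricC dm) (is_metricC rm).
- move=> p q r; rewrite /D addrACA lerD//.
    exact: (is_metric_triangle dm).
  exact: (is_metric_triangle rm).
Qed.

Let dD (p q : Y) : d (sval p).1 (sval q).1 <= D p q.
Proof. by rewrite lerDl (is_metric_ge0 rm). Qed.

Let rD (p q : Y) : baire_dist R (sval p).2 (sval q).2 <= D p q.
Proof. by rewrite lerDr (is_metric_ge0 dm). Qed.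

Let Y_separable : separable_space (metric_type D_metric).
Proof.
(* The space may be empty; otherwise [y0] is the default for those [B b] that contain no point. *)
have [[y0]|Y0] := pselect (exists y : metric_type D_metric, True); last first.
  exists set0; first exact: countable0.
  by move=> O [y _]; exfalso; apply: Y0; exists y.
(* A dense subset of the product could miss the closed set, so one point is chosen from each
   nonempty trace of a basic set. *)
pose B (b : seq K * nat * nat) : set (metric_type D_metric) :=
  [set y : Y | d (sval y).1 (a b.1.2) < b.2.+1%:R^-1 /\
               mkseq (sval y).2 (size b.1.1) = b.1.1].
exists (range (fun b => xget y0 (B b))).
  apply: sub_countable (card_image_le _ _) _; exact: countableP.
move=> O [y Oy] oO.
have [e e0 eO] : nbhs y O by exact: open_nbhs_nbhs.
(* One third for each of the two distances to [a i] and one for the Baire distance. *)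
have e3 : 0 < e / 3 by rewrite divr_gt0.
have [n ne] := filter_ex (natSinv_lt e3).
have n0 : 0 < n.+1%:R^-1 :> R by rewrite invr_gt0.
have [i yi] := adense (sval y).1 n0.
have [s sE] : exists s, s = mkseq (sval y).2 n.+1 by eexists.
have sz : size s = n.+1 by rewrite sE size_mkseq.
have /xgetPex : exists q, B (s, i, n) q by exists y; split=> //=; rewrite sz.
move=> /(_ y0); set q := xget y0 _ => -[/= qi qs].
exists q; split; last by exists (s, i, n).
apply: eO => /=.
have yq : agree n.+1 (sval y).2 (sval q).2.
  move=> j jn; move/(congr1 (fun s => nth ((sval y).2 0%N) s j)): qs.
  by rewrite sz sE !nth_mkseq.
have r1 : baire_dist R (sval y).2 (sval q).2 <= n.+1%:R^-1.
  apply: le_trans (baire_dist_le R yq) _.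
  by rewrite lef_pV2 ?posrE ?ltr0n// ler_nat.
have d1 : d (sval y).1 (sval q).1 <= d (sval y).1 (a i) + d (sval q).1 (a i).
  by rewrite (is_metricC dm (sval q).1); exact: (is_metric_triangle dm).
move: r1 d1 qi yi ne; rewrite /D; move: (n.+1%:R^-1) => u; lra.
Qed.

Let Y_complete : metric_complete (D : metric_type D_metric -> metric_type D_metric -> R).
Proof.
move=> u uC.
have [l ul] : exists l : X, (fun n => (sval (u n)).1) @ \oo --> l.
  apply: dcomplete => e e0; have [N NP] := uC e e0; exists N => m n Nm Nn.
  exact: le_lt_trans (dD _ _) (NP m n Nm Nn).
have uN i : exists N, forall m n, (N <= m)%N -> (N <= n)%N ->
    agree i.+1 (sval (u m)).2 (sval (u n)).2.
  have i0 : 0 < i.+1%:R^-1 :> R by rewrite invr_gt0.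
  have [N NP] := uC _ i0; exists N => m n Nm Nn; apply: (@baire_dist_lt R).
  exact: le_lt_trans (rD _ _) (NP m n Nm Nn).
have [N NP] := choice uN.
(* From index [N i] on, the coordinate [i] of the sequence no longer changes. *)
pose z i := (sval (u (N i))).2 i.
have uz n : exists M, forall m, (M <= m)%N -> agree n (sval (u m)).2 z.
  exists (\max_(i < n) N i)%N => m Mm i lt_in; apply: (NP i) => //.
  by apply: leq_trans Mm; exact: (leq_bigmax (Ordinal lt_in)).
have lzP k : P k l z.
  (* Since [P k] reads only a bounded initial part, the second component may be replaced by [z] for
     large [m]; closedness in the point then gives the limit. *)
  have [n nP] := localP k; have [M MP] := uz n.
  have : \forall m \near \oo, P k (sval (u m)).1 z.
    exists M => // m /= Mm; apply: nP (MP m Mm) _.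
    exact: (proj2_sig (u m)).
  by move=> H; apply: (@closed_cvg _ _ \oo _ (fun m => (sval (u m)).1)
    [set x | P k x z] (@closedP k z) H l ul).
pose y : metric_type D_metric := exist (fun p => forall k, P k p.1 p.2) (l, z) lzP.
exists y => A [e e0 eA].
have e2 : 0 < e / 2 by rewrite divr_gt0.
have [n ne] := filter_ex (natSinv_lt e2); have [M MP] := uz n.
have ul2 : \forall m \near \oo, d l (sval (u m)).1 < e / 2.
  exact: (ul _ (metric_nbhs_ball dtop l e2)).
suff : \forall m \near \oo, A (u m) by [].
apply: filterS (filterI ul2 (nbhs_infty_ge M)) => m [ml Mm]; apply: eA => /=.
rewrite /D /= [ltRHS]splitr ltrD// (is_metricC rm).
exact: le_lt_trans (baire_dist_le R (MP m Mm)) ne.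
Qed.

Lemma analytic_projection : analytic R [set x | exists z, forall k, P k x z].
Proof.
exists (metric_type D_metric), (fun y : Y => (sval y).1); split.
- split; first exact: Y_separable.
  exists D; split; [exact: D_metric|exact: metric_type_topology|exact: Y_complete].
- move=> y A /dtop[e e0 eA]; exists e => // q /= yq; apply: eA => /=.
  exact: le_lt_trans (dD _ _) yq.
- apply/seteqP; split=> [_ [y _ <-]|x [z zP]].
    by exists (sval y).2 => k; exact: (proj2_sig y).
  by exists (exist (fun p => forall k, P k p.1 p.2) (x, z) zP).
Qed.

End analytic_projection.

(** * Generic points *)

(** An open set is the union of the closed superlevel sets of a function that is positive exactly on
    it. *)
Lemma metric_open_Fsigma (R : realType) (X : ptopologicalType) (d : X -> X -> R)
    (G : set X) : is_metric d -> metric_induces_topology d -> open G -> Fsigma G.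
Proof.
move=> dm dtop oG; have [h [ch h01 hG]] := metric_open_cozero dm dtop oG.
have bh := bcont_unit ch h01.
exists (fun n => [set x | n.+1%:R^-1 <= h x]); first by move=> n; exact: bcont_closed_ge.
apply/seteqP; split=> [x /hG hx|x [n _ /= nh]].
  by have [n /ltW nh] := filter_ex (natSinv_lt hx); exists n.
by apply/hG; apply: lt_le_trans nh; rewrite invr_gt0.
Qed.

Lemma Pi03_countable (X : topologicalType) (I : countType) (F : I -> set X) :
  (forall i, Fsigma (F i)) -> Pi03 [set x | forall i, F i x].
Proof.
move=> FF; exists (fun n => if unpickle n is Some i then F i else setT).
  by move=> n; case: unpickle => [//|]; apply: closed_Fsigma; exact: closedT.
apply/seteqP; split=> [x H n _|x H i]; first by case: unpickle.
by have := H (pickle i) Logic.I; rewrite pickleK.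
Qed.

Section generic_points.
Context (R : realType) (X : ptopologicalType) (T : X -> X).
Hypothesis cT : continuous T.
Context (d : X -> X -> R).
Hypothesis dm : is_metric d.
Hypothesis dtop : metric_induces_topology d.
Hypothesis dcomplete : metric_complete d.
Context (a : nat -> X).
Hypothesis adense : forall x e, 0 < e -> exists i, d x (a i) < e.
Context (V : set (prob_measures R X)).
Hypothesis clV : closed V.

Local Notation E x n := (empirical R T x n : probability (borel X) R).
Local Notation weak_open := (weak_open d a).
Local Notation weak_closed := (weak_closed d a).
Local Notation code := (seq (seq (nat * nat * rat) * rat)).

Let closed_notin w n : closed [set x | ~ weak_open w (E x n)].
Proof. by apply: open_closedC; exact: open_empirical_weak_open. Qed.

Let closed_and (C : Prop) (A : set X) : closed A -> closed [set x | C /\ A x].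
Proof.
move=> clA; have [c|c] := pselect C.
  by rewrite (_ : mkset _ = A)//; apply/seteqP; split=> [x []|x].
by rewrite (_ : mkset _ = set0); [exact: closed0|apply/seteqP; split=> [x []|x]].
Qed.

Lemma generic_points_coanalytic : coanalytic R (generic_points T V).
Proof.
(* One sequence encodes a whole witness. The branch and the code [w] are read at coordinate 0 only,
   while [phi] and [N] use all coordinates; in the first branch [N z 0] is the threshold after which
   the open set is avoided. *)
pose K : countType := (bool * code * nat * nat)%type.
pose br (z : nat -> K) := (z 0%N).1.1.1.
pose w (z : nat -> K) := (z 0%N).1.1.2.
pose phi (z : nat -> K) k := (z k).1.2.
pose N (z : nat -> K) k := (z k).2.
(* Stage [k] tests time [k] in the first branch, and in the second one the [k]-th term with those
   tightness conditions whose two indices are at most [k], so that each stage depends on finitely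
   many coordinates. *)
pose P k x (z : nat -> K) : Prop :=
  if br z then (weak_open (w z) `&` V !=set0) /\
    ((N z 0 <= k)%N -> ~ weak_open (w z) (E x k))
  else (weak_closed (w z) `&` V = set0 /\ (phi z k < phi z k.+1)%N) /\
    (weak_closed (w z) (E x (phi z k)) /\
     forall mj : nat * nat, (mj.1 <= k)%N /\ (mj.2 <= k)%N ->
       1 - (2 ^+ mj.1)^-1 <= \int[E x (phi z mj.2)]_y
         hats d a (cover_hat mj.1 (N z mj.1)) y).
rewrite /coanalytic (_ : ~` _ = [set x | exists z, forall k, P k x z]).
  apply: (analytic_projection dm dtop dcomplete adense).
    move=> k z; rewrite /P; case: (br z); apply: closed_and.
      have [Nk|Nk] := leqP (N z 0) k.
        rewrite (_ : (fun x => _) = [set x | ~ weak_open (w z) (E x k)])//.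
        by apply/seteqP; split=> x; [apply|].
      by rewrite (_ : (fun x => _) = setT); [exact: closedT|apply/seteqP; split].
    apply: (@closedI _ [set x | weak_closed (w z) (E x (phi z k))]).
      exact: closed_empirical_weak_closed.
    apply: (@closed_bigI _ _ [set mj : nat * nat | (mj.1 <= k)%N /\ (mj.2 <= k)%N]
      (fun mj => [set x | 1 - (2 ^+ mj.1)^-1 <= \int[E x (phi z mj.2)]_y
         hats d a (cover_hat mj.1 (N z mj.1)) y])) => mj _.
    apply: bcont_closed_ge.
    by apply: bcont_integral_empirical => //; [exact: bcont_hats|exact: hats_ge0].
  (* Stage [k] reads the coordinates up to [k.+1], the last one for the monotonicity of [phi]. *)
  move=> k; exists k.+2 => z z' x zz'.
  rewrite /P /br /w /N /phi !(zz' 0%N)//; case: ifP => // _.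
  rewrite !(zz' k)// (zz' k.+1)// => -[? [? tz]]; split=> //; split=> //.
  move=> mj [m1 m2]; rewrite -(zz' mj.1) 1?ltnS 1?ltnW// -(zz' mj.2) 1?ltnS 1?ltnW//.
  exact: tz.
have not_eq x : (~` generic_points T V) x <->
    ~ (V `<=` limit_measures T x) \/ ~ (limit_measures T x `<=` V).
  split=> [H|[H|H] xV].
  - apply: contrapT => /not_orP[/contrapT H1 /contrapT H2].
    by apply: H; apply/seteqP; split.
  - by apply: H; rewrite xV.
  - by apply: H; rewrite xV.
apply/seteqP; split=> x.
  move=> /not_eq[/(not_sub_limit_measures T dm dtop adense V x)|
                 /(limit_measures_not_sub T dm dtop adense dcomplete clV x)].
    move=> [w0 [N0 [w0V H]]]; exists (fun=> (true, w0, 0%N, N0)) => k.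
    by rewrite /P/=; split=> // /H.
  move=> [w0 [phi0 [N0 [w0V phiI tight H]]]].
  exists (fun k => (false, w0, phi0 k, N0 k)) => k; rewrite /P/=; split.
    by split=> //; move/increasing_seqP: phiI => /(_ k); rewrite ltEnat.
  by split=> // mj _; exact: tight.
move=> [z zP]; apply/not_eq; case bz: (br z).
  left; apply/(not_sub_limit_measures T dm dtop adense V x).
  exists (w z), (N z 0%N); split=> [|n Nn].
    by have := zP 0%N; rewrite /P bz => -[].
  by have := zP n; rewrite /P bz => -[_]; apply.
right; apply/(limit_measures_not_sub T dm dtop adense dcomplete clV x).
exists (w z), (phi z), (N z); split.
- by have := zP 0%N; rewrite /P bz => -[[]].
- by apply/increasing_seqP => k; have := zP k; rewrite /P bz ltEnat => -[[]].
(* The pair [(m, j)] is tested from stage [maxn m j] on. *)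
- move=> m j; have := zP (maxn m j); rewrite /P bz => -[_ [_ /(_ (m, j))]].
  by apply; rewrite leq_maxl leq_maxr.
- by move=> k; have := zP k; rewrite /P bz => -[_ []].
Qed.

Lemma generic_points_Pi03 : compact [set: X] -> Pi03 (generic_points T V).
Proof.
move=> cX.
(* The left codes express that [V] is contained in the set of limit measures, by open conditions;
   the right codes express the converse inclusion, by countable unions of closed conditions. The
   premises do not involve [x]. *)
pose F (i : code * nat + code) : set X := match i with
  | inl (w, N) => [set x | weak_open w `&` V !=set0 ->
      exists2 n, (N <= n)%N & weak_open w (E x n)]
  | inr w => [set x | weak_closed w `&` V = set0 ->
      exists N, forall n, (N <= n)%N -> ~ weak_open w (E x n)]
  end.
have FsigmaT : Fsigma [set: X] by apply: closed_Fsigma; exact: closedT.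
have FsF i : Fsigma (F i).
  case: i => [[w N]|w] /=.
    have [wV|wV] := pselect (weak_open w `&` V !=set0); last first.
      by rewrite (_ : mkset _ = setT)//; apply/seteqP; split=> // x _ /wV.
    apply: (metric_open_Fsigma dm dtop).
    rewrite (_ : mkset _ = \bigcup_(n in [set n | (N <= n)%N])
      [set x | weak_open w (E x n)]).
      by apply: bigcup_open => n _; exact: open_empirical_weak_open.
    apply/seteqP; split=> x /=; first by move=> /(_ wV)[n]; exists n.
    by move=> [n] ? ? _; exists n.
  have [wV|wV] := pselect (weak_closed w `&` V = set0); last first.
    by rewrite (_ : mkset _ = setT)//; apply/seteqP; split=> // x _ /wV.
  exists (fun N => \bigcap_(n in [set n | (N <= n)%N]) [set x | ~ weak_open w (E x n)]).
    by move=> N; apply: closed_bigI => n _; exact: closed_notin.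
  apply/seteqP; split=> x /=; first by move=> /(_ wV)[N NP]; exists N.
  by move=> [N _ NP] _; exists N.
rewrite (_ : generic_points T V = [set x | forall i, F i x]).
  exact: Pi03_countable.
apply/seteqP; split=> [x xV [[w N] [mu [wmu Vmu]]|w wV]|x H].
- apply: (limit_measures_frequently dm dtop N _ wmu).
  by rewrite xV.
- apply: contrapT => H.
  have {}H (k N : nat) : exists2 n, (N <= n)%N & weak_closed w (E x n).
    apply: contrapT => H1; apply: H; exists N => n Nn wn; apply: H1.
    by exists n => //; exact: weak_open_closed wn.
  have [phi phiI phiw] := frequently_subseq H.
  (* Compactness makes the cover bound uniform over all points, hence valid for the integral against
     any probability measure. *)
  have cN m : exists N, forall x, 1 - (2 ^+ m)^-1 <= hats d a (cover_hat m N) x.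
    by apply: (compact_cover_hat dm dtop adense) => //; rewrite invr_gt0 exprn_gt0.
  have [N NP] := choice cN.
  suff : ~ (limit_measures T x `<=` V) by rewrite xV; apply.
  apply/(limit_measures_not_sub T dm dtop adense dcomplete clV x).
  exists w, phi, N; split=> // m k.
  rewrite -[leLHS](integral_prob_cst (E x (phi k))).
  apply: le_integral_bcont => //; first exact: bcont_cst.
  exact: bcont_hats.
apply/seteqP; split; last first.
  apply: contrapT => /(not_sub_limit_measures T dm dtop adense V x)[w [N [wV NP]]].
  by have [n /NP] := H (inl (w, N)) wV.
move=> mu xmu; apply: contrapT => Vmu.
have [w wmu wV] := limit_measures_separated dm dtop adense clV xmu Vmu.
have [N NP] := H (inr w) wV.
by have [n /NP] := limit_measures_frequently dm dtop N xmu wmu.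
Qed.

End generic_points.

Lemma separable_dense_seq (R : realType) (X : ptopologicalType) (d : X -> X -> R) :
  metric_induces_topology d -> separable_space X ->
  exists a : nat -> X, forall x e, 0 < e -> exists i, d x (a i) < e.
Proof.
move=> dtop [D /countable_injP[f finj] dD].
(* The injection of [D] into the natural numbers is inverted; numbers outside its image are sent to
   the default [point]. *)
exists (fun n => xget point [set x | D x /\ f x = n]) => x e e0.
have xe : nbhs x [set y | d x y < e] by apply/dtop; exists e.
have [|y [ye Dy]] := dD (interior [set y | d x y < e]) _ (@open_interior _ _).
  by exists x.
exists (f y); suff -> : xget point [set x0 | D x0 /\ f x0 = f y] = y.
  exact: (interior_subset ye).
case: xgetP => [z -> [Dz fzy]|/(_ y)/= []//].
by apply: finj => //; rewrite inE.
Qed.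

Theorem fact21 (R : realType) (X : ptopologicalType) (T : X -> X)
    (hX : polish_space R X) (hT : continuous T)
    (V : set (prob_measures R X)) (hVT : V `<=` invariant_measures T)
    (hV : closed V) :
  coanalytic R (generic_points T V) /\
  (compact [set: X] -> Pi03 (generic_points T V)).
Proof.
have [sX [d [dm dtop dcomplete]]] := hX.
have [a adense] := separable_dense_seq dtop sX.
split; first exact: (generic_points_coanalytic hT dm dtop dcomplete adense hV).
exact: (generic_points_Pi03 hT dm dtop dcomplete adense hV).
Qed.
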